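(* Let $H^\omega$, $\Lambda_L$, $H^\omega_{\Lambda_L}$, $\beta_L$, $\gamma_L$ be as in the context, with $\alpha>0$, $\delta>1$ and $d-\alpha(\delta-1)>0$. Let $M_1<-2d$ and $M_2>2d$, and let $\gamma_L\upharpoonright_{(M_1,M_2)^c}$ denote the restriction of $\gamma_L$ to $\mathbb{R}\setminus(M_1,M_2)$. Then the sequence of measures $\{\gamma_L\upharpoonright_{(M_1,M_2)^c}\}_L$ admits a subsequence which converges vaguely to a non-trivial (i.e. nonzero) measure $\gamma$ on $\mathbb{R}\setminus(M_1,M_2)$.
   Context: Let $d\ge1$ be an integer. Let $\{q_n\}_{n\in\mathbb{Z}^d}$ be i.i.d. real random variables on a probability space $(\Omega,\mathcal{B},\mathbb{P})$ (expectation $\mathbb{E}$), whose common distribution $\mu$ has density $\rho(x)=0$ for $|x|<1$ and $\rho(x)=\frac{\delta-1}{2}|x|^{-\delta}$ for $|x|\ge1$, for some $\delta>1$. Let $\{a_n\}_{n\in\mathbb{Z}^d}$ be positive reals with $a_n\simeq|n|^{-\alpha}$, $\alpha>0$ (i.e. there are constants $0<c_1\le c_2$ with $c_1|n|^{-\alpha}\le a_n\le c_2|n|^{-\alpha}$ for all $n\ne0$; $|\cdot|$ is the Euclidean norm). Assume $d-\alpha(\delta-1)>0$. On $\ell^2(\mathbb{Z}^d)$, with standard basis $\{\delta_n\}$, let $(\Delta u)(n)=\sum_{|m-n|=1}u(m)$ and $H^\omega=-\Delta+V^\omega$, where $(V^\omega u)(n)=a_nq_n(\omega)u(n)$. For $L\in\mathbb{N}$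 let $\Lambda_L=\{n\in\mathbb{Z}^d:|n_i|\le L,\ i=1,\dots,d\}$ and let $H^\omega_{\Lambda_L}$ be the finite symmetric matrix $(\langle\delta_n,H^\omega\delta_m\rangle)_{n,m\in\Lambda_L}$. Put $\beta_L=\sum_{n\in\Lambda_L}a_n^{\delta-1}$ (which tends to $\infty$ as $L\to\infty$). Define the Borel measure $\gamma_L(\cdot)=\frac{1}{\beta_L}\sum_{n\in\Lambda_L}\mathbb{E}\big(\langle\delta_n,E_{H^\omega_{\Lambda_L}}(\cdot)\delta_n\rangle\big)$ on $\mathbb{R}$, where $E_{H^\omega_{\Lambda_L}}$ is the spectral projection-valued measure of $H^\omega_{\Lambda_L}$; equivalently $\gamma_L(B)$ is $\beta_L^{-1}$ times the expected number of eigenvalues of $H^\omega_{\Lambda_L}$ in $B$, counted with multiplicity. Vague convergence on the closed set $\mathbb{R}\setminus(M_1,M_2)$ means convergence of integrals of every continuous compactly supported function on that set. *)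

(* Defs.v *)
From HB Require Import structures.
From mathcomp Require Import all_boot all_order all_algebra finmap.
From mathcomp Require Import all_classical all_reals all_analysis.

Set Implicit Arguments.
Unset Strict Implicit.
Unset Printing Implicit Defensive.

Import Order.TTheory GRing.Theory Num.Theory.
Import numFieldNormedType.Exports.

Local Open Scope classical_set_scope.
Local Open Scope ring_scope.

(* Points of the lattice Z^d are row vectors 'rV[int]_d. *)
Definition enorm (R : realType) (d : nat) (n : 'rV[int]_d) : R :=
  Num.sqrt (\sum_(i < d) (n 0 i)%:~R ^+ 2).

Definition Lambda (d L : nat) : set 'rV[int]_d :=
  [set n | forall i, `|n 0 i| <= L%:Z].

Definition neighbours (R : realType) (d : nat) (n : 'rV[int]_d) :
    set 'rV[int]_d :=
  [set m | enorm R (m - n) = 1].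

Arguments Lambda d L : clear implicits.

(* The two finiteness lemmas rule out the junk values that [fset_set] and
   [\sum_(_ \in _)] take on infinite sets. *)
Lemma finite_Lambda (d L : nat) : finite_set (Lambda d L).
Proof.
pose g (f : {ffun 'I_d -> 'I_(L + L).+1}) : 'rV[int]_d :=
  \row_i ((f i)%:Z - L%:Z).
apply: (@sub_finite_set _ _ (g @` setT)); last exact: finite_image.
move=> n nL; exists [ffun i => inord (absz (n 0 i + L%:Z))] => //.
apply/rowP => i; rewrite mxE ffunE.
move: (nL i) => /=; rewrite ler_norml => /andP[nl nr].
have n0 : 0 <= n 0 i + L%:Z by rewrite -lerBlDr sub0r.
rewrite inordK; first by rewrite gez0_abs// addrK.
by rewrite ltnS -lez_nat gez0_abs// PoszD lerD2r.
Qed.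

Lemma finite_neighbours (R : realType) (d : nat) (n : 'rV[int]_d) :
  finite_set (neighbours R n).
Proof.
apply: (@sub_finite_set _ _ ((fun k => k + n) @` Lambda d 1)); last first.
  by apply: finite_image; exact: finite_Lambda.
move=> m; rewrite /neighbours /enorm /= => mn; exists (m - n); last first.
  by rewrite subrK.
move=> i; set k := m - n in mn *.
have k0 : 0 <= \sum_(i < d) ((k 0 i)%:~R : R) ^+ 2.
  by apply: sumr_ge0 => j _; exact: sqr_ge0.
have k1 : \sum_(i < d) ((k 0 i)%:~R : R) ^+ 2 = 1.
  by rewrite -(sqr_sqrtr k0) mn expr1n.
have : ((k 0 i)%:~R : R) ^+ 2 <= 1.
  rewrite -[leRHS]k1 (bigD1 i)//= lerDl.
  by apply: sumr_ge0 => j _; exact: sqr_ge0.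
by rewrite -[in X in X -> _]real_normK ?num_real// expr_le1// -intr_norm lerz1.
Qed.

Definition laplacian (R : realType) (d : nat) (u : 'rV[int]_d -> R) :
    'rV[int]_d -> R :=
  fun n => \sum_(m \in neighbours R n) u m.

Definition potential (R : realType) (d : nat) (a q : 'rV[int]_d -> R)
    (u : 'rV[int]_d -> R) : 'rV[int]_d -> R :=
  fun n => a n * q n * u n.

Definition hamiltonian (R : realType) (d : nat) (a q : 'rV[int]_d -> R)
    (u : 'rV[int]_d -> R) : 'rV[int]_d -> R :=
  fun n => - laplacian u n + potential a q u n.

Definition basis_vector (R : realType) (d : nat) (m : 'rV[int]_d) :
    'rV[int]_d -> R :=
  fun n => (n == m)%:R.

Definition Lambda_card (d L : nat) : nat := #|` fset_set (Lambda d L)|.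

Definition Lambda_site (d L : nat) (i : 'I_(Lambda_card d L)) : 'rV[int]_d :=
  nth 0 (fset_set (Lambda d L)) i.

(* The pairing <delta_n, H delta_m> is the value of H delta_m at n. *)
Definition hamiltonian_box (R : realType) (d : nat) (a q : 'rV[int]_d -> R)
    (L : nat) : 'M[R]_(Lambda_card d L) :=
  \matrix_(i, j) hamiltonian a q (basis_vector R (Lambda_site j)) (Lambda_site i).

(* Orthogonal projection onto the eigenspace: the projection along its
   orthogonal complement for the standard scalar product. *)
Definition eigenprojection (R : realType) (N : nat) (A : 'M[R]_N) (l : R) :
    'M[R]_N :=
  proj_mx (eigenspace A l) (orthomx idfun 1%:M (eigenspace A l)).

Definition spectral_measure (R : realType) (N : nat) (A : 'M[R]_N)
    (B : set R) : 'M[R]_N :=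
  \sum_(l \in [set l | eigenvalue A l] `&` B) eigenprojection A l.

Definition beta (R : realType) (d : nat) (a : 'rV[int]_d -> R) (delta : R)
    (L : nat) : R :=
  \sum_(n \in Lambda d L) a n `^ (delta - 1).

Definition gammaL (disp : measure_display) (Omega : measurableType disp)
    (R : realType) (P : probability Omega R) (d : nat)
    (a : 'rV[int]_d -> R) (q : 'rV[int]_d -> Omega -> R) (delta : R)
    (L : nat) (B : set R) : \bar R :=
  ((beta a delta L)^-1%:E *
   \sum_(i < Lambda_card d L)
     'E_P[fun w =>
       spectral_measure (hamiltonian_box a (fun n => q n w) L) B i i])%E.

Definition rho (R : realType) (delta x : R) : R :=
  if `|x| < 1 then 0 else (delta - 1) / 2 * `|x| `^ (- delta).

Definition has_density (disp : measure_display) (Omega : measurableType disp)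
    (R : realType) (P : probability Omega R) (X : {RV P >-> R})
    (f : R -> R) : Prop :=
  forall B : set R, measurable B ->
    distribution P X B = (\int[lebesgue_measure]_(x in B) (f x)%:E)%E.

Definition mutually_independent (disp : measure_display)
    (Omega : measurableType disp) (R : realType) (P : probability Omega R)
    (I : choiceType) (X : I -> {RV P >-> R}) : Prop :=
  forall (s : {fset I}) (B : I -> set R), (forall i, measurable (B i)) ->
    P (\bigcap_(i in [set` s]) (X i @^-1` B i)) =
    (\prod_(i <- s) P (X i @^-1` B i))%E.

Definition comparable_to_power (R : realType) (d : nat) (a : 'rV[int]_d -> R)
    (alpha : R) : Prop :=
  exists c1 c2 : R, [/\ 0 < c1, c1 <= c2 &
    forall n, n != 0 ->
      c1 * enorm R n `^ (- alpha) <= a n <= c2 * enorm R n `^ (- alpha)].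

Definition outside (R : realType) (M1 M2 : R) : set R := ~` `]M1, M2[.

Lemma measurable_outside (R : realType) (M1 M2 : R) :
  measurable (outside M1 M2).
Proof. by apply: measurableC; exact: measurable_itv. Qed.

Definition compact_support_in (R : realType) (S : set R) (f : R -> R) : Prop :=
  exists K : set R, [/\ compact K, K `<=` S &
    forall x, S x -> ~ K x -> f x = 0].

(* Functions and measures on the closed subspace [S] are represented on the
   whole line; their values off [S] are irrelevant. *)
Definition vague_cvg_on (R : realType) (S : set R)
    (mu_ : nat -> {measure set R -> \bar R}) (mu : {measure set R -> \bar R}) :
    Prop :=
  forall f : R -> R, {within S, continuous f} -> compact_support_in S f ->
    (\int[mu_ k]_(x in S) (f x)%:E)%E @[k --> \oo]
      --> (\int[mu]_(x in S) (f x)%:E)%E.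

(* A Borel measure carried by [S] and finite on compact subsets of [S]. *)
Definition locally_finite_on (R : realType) (S : set R)
    (mu : {measure set R -> \bar R}) : Prop :=
  mu (~` S) = 0%E /\ forall K, compact K -> K `<=` S -> (mu K < +oo)%E.

(* Main.v *)
Require Import Defs.
From HB Require Import structures.
From mathcomp Require Import all_boot all_order all_algebra finmap.
From mathcomp Require Import all_classical all_reals all_analysis.
From mathcomp Require Import measurable_realfun complex ring lra.

(** In the box, the Hamiltonian is [- adjacency + V], where [V] is the diagonal
    matrix of the [a_n q_n] and the adjacency matrix has norm at most [2 d].
    Hence eigenvectors for eigenvalues [r] with [|r| >= 2 d + 2 e] carry a fixed
    fraction of their mass on the sites with [|V_n| >= e], and the expected
    number of such sites is at most a constant times
    [\sum_n a_n ^ (delta - 1) = beta_L]: the restricted measures have bounded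
    mass. Conversely, the spectral measure at the site [n] gives mass at least
    [1 / 2] to [[V_n - 2 d, V_n + 2 d]], and [V_n] lies in [[A, 2 A]] with
    probability a constant times [a_n ^ (delta - 1)] as soon as [A] bounds all
    the [a_n]: a compact interval to the right of [M2] keeps a mass bounded
    below, uniformly in [L]. Helly's selection theorem then gives a subsequence
    with a limit, which is nonzero because no mass of that interval is lost. *)

Set Implicit Arguments.
Unset Strict Implicit.
Unset Printing Implicit Defensive.

Import Order.TTheory GRing.Theory Num.Theory.
Import numFieldNormedType.Exports.

Local Open Scope classical_set_scope.
Local Open Scope ring_scope.

(** * Spectral theorem for real symmetric matrices *)

(** The normalisation by [beta] comes from scaling: P(|q_n| >= t) is of order t^(1 - delta), so for
    fixed e the event a_n |q_n| >= e has probability of order a_n^(delta - 1), and both mass bounds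
    are obtained site by site at this rate. The strict inequalities M1 < -2d and M2 > 2d leave a
    margin 2e beyond the norm bound of the adjacency matrix; as e tends to 0 the guaranteed mass
    fraction degenerates to 0. Before any estimate, [gammaL] must be shown to be a measure, so the
    entries of the spectral projections must depend measurably on the random parameter. The
    eigenvalues, and even their number, vary with it; a measurable enumeration is avoided by writing
    the projections of open intervals as limits of rational functions of the matrix. Helly's theorem
    is applied on the whole line to measures carried by the complement of ]M1, M2[: test functions
    given only there are extended across the gap, and the limit must be shown not to charge it. *)

(* Over [R[i]] the matrix is unitarily diagonalizable with real eigenvalues, so
   its minimal polynomial, which does not depend on the field, is split with
   simple roots over [R]. *)
Lemma symmetric_diagonalizable (R : rcfType) (N : nat) (A : 'M[R]_N) :
  A^T = A ->
  exists2 rs, uniq rs & (\sum_(r <- rs) eigenspace A r :=: 1%:M)%MS.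
Proof.
case: N A => [|N] A symA.
  by exists [::] => //; rewrite big_nil [1%:M]thinmx0.
pose f := real_complex R.
pose B : 'M[R[i]%C]_N.+1 := map_mx f A.
have Bsym : B \is symmetricmx.
  apply/is_hermitianmxP.
  by rewrite expr0 scale1r map_mx_id// map_trmx symA.
have Breal : B \is a mxOver Num.real.
  by apply/mxOverP => i j; rewrite mxE; apply/complex_realP; eexists.
have Bherm := realsym_hermsym Bsym Breal.
have /orthomx_spectralP BE := hermitian_normalmx Bherm.
have Dreal := hermitian_spectral_diag_real Bherm.
set D := spectral_diag B in BE Dreal.
pose rs := undup [seq complex.Re (D 0 i) | i <- enum 'I_N.+1].
apply/diagonalizablePeigen/diagonalizableP.
exists rs; first exact: undup_uniq.
rewrite -(dvdp_map f) -mxminpoly_map -/B BE.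
rewrite -conjVmx ?spectral_unit//.
rewrite mxminpoly_uconj ?unitmx_inv ?spectral_unit// mxminpoly_diag.
rewrite rmorph_prod/=.
rewrite (eq_bigr (fun r => 'X - (f r)%:P)); last first.
  by move=> r _; rewrite rmorphB/= map_polyX map_polyC.
rewrite -(big_map f predT (fun r => 'X - r%:P)).
rewrite -undup_map_inj; last exact: complexI.
have -> : [seq f x | x <- [seq complex.Re (D 0 i) | i <- enum 'I_N.+1]] =
    [seq D 0 i | i <- enum 'I_N.+1].
  rewrite -map_comp; apply: eq_map => i /=.
  by rewrite /f RRe_real//; move/mxOverP: Dreal; apply.
by rewrite enumT dvdpp.
Qed.

Section eigenprojections.
Context {R : realType} {N : nat} (A : 'M[R]_N).
Hypothesis symA : A^T = A.

Let P := eigenprojection A.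
Let W r := orthomx idfun 1%:M (eigenspace A r).

Lemma row_selfmul_eq0 (u : 'rV[R]_N) : u *m u^T = 0 -> u = 0.
Proof.
move=> /matrixP /(_ 0 0); rewrite !mxE => /eqP.
rewrite psumr_eq0; last by move=> i _; rewrite mxE -expr2 sqr_ge0.
move=> /allP u0; apply/rowP => i; rewrite mxE.
by have := u0 i (mem_index_enum _); rewrite mxE mulf_eq0 orbb => /eqP.
Qed.

Let orthoE m (u : 'M[R]_(m, N)) r :
  (u <= W r)%MS = (u *m (eigenspace A r)^T == 0).
Proof. by rewrite (sameP sub_kermxP eqP) mul1mx map_mx_id. Qed.

(** Positivity of the scalar product over the reals: a vector u in both spaces satisfies u u^T =
    0. *)
Lemma eigenspace_cap_ortho r : (eigenspace A r :&: W r = 0)%MS.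
Proof.
apply/eqP; rewrite -submx0; apply/rV_subP => u; rewrite sub_capmx.
case/andP => /submxP[v uE]; rewrite orthoE => /eqP u0.
suff -> : u = 0 by rewrite sub0mx.
by apply: row_selfmul_eq0; rewrite {2}uE trmx_mul mulmxA u0 mul0mx.
Qed.

Lemma eigenprojection_id m (U : 'M[R]_(m, N)) r :
  (U <= eigenspace A r)%MS -> U *m P r = U.
Proof. exact/proj_mx_id/eigenspace_cap_ortho. Qed.

Lemma eigenprojection_sub r : (P r <= eigenspace A r)%MS.
Proof. by rewrite -[P r]mul1mx proj_mx_sub. Qed.

Lemma eigenprojectionl r : P r *m A = r *: P r.
Proof. exact/eigenspaceP/eigenprojection_sub. Qed.

(** Symmetry of [A] moves it across the scalar product, so the pairing of the two eigenspaces is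
    multiplied by r and by s alike. *)
Lemma eigenprojection_orthogonal m (U : 'M[R]_(m, N)) r s :
  r != s -> (U <= eigenspace A s)%MS -> U *m P r = 0.
Proof.
move=> rs /eigenspaceP Us; apply: proj_mx_0; first exact: eigenspace_cap_ortho.
rewrite orthoE; set E := eigenspace A r.
have /eigenspaceP rE : (E <= eigenspace A r)%MS by [].
have : s *: (U *m E^T) = r *: (U *m E^T).
  rewrite scalemxAl -Us -mulmxA -{1}symA -trmx_mul rE.
  by rewrite linearZ/= -scalemxAr.
move/eqP; rewrite -subr_eq0 -scalerBl scaler_eq0 subr_eq0 eq_sym.
by rewrite (negbTE rs).
Qed.

Lemma eigenprojectionM r s : P r *m P s = (r == s)%:R *: P r.
Proof.
have [<-|rs] := eqVneq r s.
  by rewrite scale1r eigenprojection_id// eigenprojection_sub.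
by rewrite scale0r (eigenprojection_orthogonal _ (eigenprojection_sub r))// eq_sym.
Qed.

Section resolution.
Variables (rs : seq R).
Hypotheses (urs : uniq rs) (rsP : (\sum_(r <- rs) eigenspace A r :=: 1%:M)%MS).

(** The difference of the two sides is killed by every eigenspace, and the eigenspaces together span
    the whole space. *)
Lemma sum_eigenprojection : \sum_(r <- rs) P r = 1%:M.
Proof.
apply/eqP; rewrite -subr_eq0 -[X in X == _]mul1mx; apply/eqP/sub_kermxP.
rewrite -rsP big_seq; elim/big_ind: _.
- exact: sub0mx.
- by move=> x y xK yK; rewrite addsmx_sub xK yK.
move=> s srs; apply/sub_kermxP; rewrite mulmxBr mulmx1 mulmx_sumr.
rewrite (bigD1_seq s)//= eigenprojection_id// big1 ?addr0 ?subrr// => r rs'.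
by rewrite (eigenprojection_orthogonal _ (submx_refl _)).
Qed.

Lemma eigenprojection_notin r : r \notin rs -> P r = 0.
Proof.
move=> rrs; rewrite -[P r]mulmx1 -sum_eigenprojection mulmx_sumr.
rewrite big_seq big1// => s srs; rewrite eigenprojectionM.
by case: eqVneq srs rrs => [-> ->//|]; rewrite scale0r.
Qed.

Lemma eigenprojectionr r : A *m P r = r *: P r.
Proof.
rewrite -[A in LHS]mul1mx -sum_eigenprojection.
rewrite -{2}[P r]mul1mx -sum_eigenprojection.
rewrite !mulmx_suml scaler_sumr; apply: eq_bigr => s _.
rewrite eigenprojectionl -scalemxAl eigenprojectionM !scalerA.
by have [->|] := eqVneq s r; rewrite ?mulr0 ?scale0r.
Qed.

(** Transposing A P_r = r P_r puts the rows of P_r^T in the eigenspace, so P_r^T P_r = P_r^T; the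
    left side is symmetric. *)
Lemma tr_eigenprojection r : (P r)^T = P r.
Proof.
have PrT : (P r)^T *m P r = (P r)^T.
  apply: eigenprojection_id; apply/eigenspaceP.
  by rewrite -{1}symA -trmx_mul eigenprojectionr linearZ.
by move: (congr1 trmx PrT); rewrite trmx_mul !trmxK PrT.
Qed.

Lemma spectral_measureE (B : set R) :
  spectral_measure A B = \sum_(r <- rs | r \in B) P r.
Proof.
rewrite /spectral_measure.
have PE l : P l != 0 -> eigenvalue A l.
  move=> Pl; apply: contraNT Pl; rewrite negbK => /eqP E0.
  by have := eigenprojection_sub l; rewrite E0 submx0.
(* The index set of the sum changes from the eigenvalues in [B] to the members of [rs] in [B]: any
   extra member has a zero projection. *)
rewrite (@fsbig_widen _ _ _ _ _ ([set` rs] `&` B)); last 2 first.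
- move=> l [/= El Bl]; split=> //=; apply: contraT => /eigenprojection_notin P0.
  case/eigenvalueP: El => v /eigenspaceP vE /eqP[].
  by rewrite -(eigenprojection_id vE) P0 mulmx0.
- move=> l [[/= _ Bl] El]; apply/eqP; apply: contraT => /PE El'.
  by case: El; split.
by rewrite fsbig_mkcondr -fsbig_seq// -big_mkcond.
Qed.
End resolution.

Lemma spectral_resolution : exists rs, [/\ uniq rs, \sum_(r <- rs) P r = 1%:M,
  forall r, A *m P r = r *: P r, forall r, (P r)^T = P r &
  forall B, spectral_measure A B = \sum_(r <- rs | r \in B) P r].
Proof.
have [rs urs rsP] := symmetric_diagonalizable symA.
exists rs; split; first exact: urs.
- exact: sum_eigenprojection.
- move=> r; exact: (eigenprojectionr urs rsP).
- move=> r; exact: (tr_eigenprojection urs rsP).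
- move=> B; exact: spectral_measureE.
Qed.

End eigenprojections.

(** * Measurability of the spectral measure *)

Section measurable_mx.
Context {d : measure_display} {T : measurableType d} {R : realType}.

Definition measurable_mx (m n : nat) (M : T -> 'M[R]_(m, n)) : Prop :=
  forall i j, measurable_fun setT (fun w => M w i j).

Lemma measurable_mx_cst m n (A : 'M[R]_(m, n)) : measurable_mx (fun=> A).
Proof. by move=> i j; exact: measurable_cst. Qed.

Lemma measurable_mxD m n (M1 M2 : T -> 'M[R]_(m, n)) :
  measurable_mx M1 -> measurable_mx M2 ->
  measurable_mx (fun w => M1 w + M2 w).
Proof.
move=> m1 m2 i j; under eq_fun do rewrite mxE.
exact: measurable_funD (m1 i j) (m2 i j).
Qed.

Lemma measurable_mxZ m n k (M : T -> 'M[R]_(m, n)) :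
  measurable_mx M -> measurable_mx (fun w => k *: M w).
Proof.
move=> mM i j; under eq_fun do rewrite mxE.
by apply: measurable_funM (mM i j); exact: measurable_cst.
Qed.

Lemma measurable_mxM m n p (M1 : T -> 'M[R]_(m, n)) (M2 : T -> 'M[R]_(n, p)) :
  measurable_mx M1 -> measurable_mx M2 ->
  measurable_mx (fun w => M1 w *m M2 w).
Proof.
move=> m1 m2 i j; under eq_fun do rewrite mxE.
by apply: measurable_sum => k; exact: measurable_funM (m1 i k) (m2 k j).
Qed.

Lemma measurable_mxX n (M : T -> 'M[R]_n) k :
  measurable_mx M -> measurable_mx (fun w => M w ^+ k).
Proof.
move=> mM; elim: k => [|k ih]; first exact: measurable_mx_cst.
by under [X in measurable_mx X]eq_fun do rewrite exprS; exact: measurable_mxM.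
Qed.

Lemma measurable_det n (M : T -> 'M[R]_n) :
  measurable_mx M -> measurable_fun setT (fun w => \det (M w)).
Proof.
move=> mM; apply: measurable_sum => s.
apply: measurable_funM; first exact: measurable_cst.
by apply: measurable_prod => i _; exact: mM.
Qed.

(** Writing 1/f as f (f^2)^(-1) reduces to a real power of a nonnegative function; the identity also
    holds at zeros of f, where the inverse is 0 by convention. *)
Lemma measurable_funV (f : T -> R) :
  measurable_fun setT f -> measurable_fun setT (fun w => (f w)^-1).
Proof.
move=> mf.
have -> : (fun w => (f w)^-1) = (fun w => f w * ((f w ^+ 2) `^ (-1))).
  apply/funext => w; rewrite powR_inv1 ?sqr_ge0// expr2 invfM.
  by have [->|f0] := eqVneq (f w) 0; rewrite ?invr0 ?mul0r// mulrA divff ?mul1r.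
apply: measurable_funM => //.
exact: (measurableT_comp (measurable_powR (-1)) (measurable_funX 2 mf)).
Qed.

(** Cramer's formula: the entries are polynomials in those of M, divided by the determinant. *)
Lemma measurable_invmx n (M : T -> 'M[R]_n) :
  (forall w, M w \in unitmx) ->
  measurable_mx M -> measurable_mx (fun w => invmx (M w)).
Proof.
move=> uM mM i j.
have -> : (fun w => invmx (M w) i j) =
          (fun w => (\det (M w))^-1 * (\adj (M w)) i j).
  by apply/funext => w; rewrite /invmx uM mxE.
apply: measurable_funM; first by apply: measurable_funV; exact: measurable_det.
under eq_fun do rewrite mxE.
apply: measurable_funM; first exact: measurable_cst.
by apply: measurable_det => k l; under eq_fun do rewrite !mxE; exact: mM.
Qed.

End measurable_mx.

Lemma cvg_natM_expr_sqr (R : realType) (s : R) : 0 <= s < 1 ->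
  (n%:R * (s ^+ 2) ^+ n) @[n --> \oo] --> 0.
Proof.
move=> /andP[s0 s1].
have ub n : n%:R * s ^+ n <= (1 - s)^-1.
  (* The added term s^n makes the bound inductive: each expression is s times the previous one plus
     s^(n+1) (1 - s). *)
  suff : n%:R * s ^+ n * (1 - s) + s ^+ n <= 1.
    move=> h; rewrite -[leRHS]mul1r ler_pdivlMr ?subr_gt0//.
    by rewrite (le_trans _ h)// lerDl exprn_ge0.
  elim: n => [|n ih]; first by rewrite !mul0r add0r expr0.
  have -> : n.+1%:R * s ^+ n.+1 * (1 - s) + s ^+ n.+1 =
    s * (n%:R * s ^+ n * (1 - s) + s ^+ n) + s ^+ n.+1 * (1 - s).
    by rewrite !exprS -natr1; ring.
  have h1 := ler_wpM2l s0 ih.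
  have h2 : s ^+ n.+1 * (1 - s) <= 1 * (1 - s).
    by apply: ler_wpM2r; rewrite ?subr_ge0 ?exprn_ile1// ltW.
  by apply: (le_trans (lerD h1 h2)); rewrite mulr1 mul1r addrC subrK.
apply: (@squeeze_cvgr _ _ _ _ (fun=> 0) (fun n => (1 - s)^-1 * s ^+ n)).
- near=> n; rewrite mulr_ge0 ?ler0n ?exprn_ge0 ?sqr_ge0//=.
  by rewrite exprAC expr2 mulrA ler_wpM2r ?exprn_ge0.
- exact: cvg_cst.
- by apply: cvg_geometric; rewrite ger0_norm.
Unshelve. all: by end_near. Qed.

(* These functions of [x] only involve ring operations and an inverse, so that
   applied to a matrix they yield a measurable function of its entries. *)
Lemma cvg_indicator_ball (R : realType) (c e x : R) : 0 < e ->
  (1 + n%:R * (((x - c) / e) ^+ 2) ^+ n)^-1 @[n --> \oo] -->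
  ((x \in `]c - e, c + e[%classic)%:R : R).
Proof.
move=> e0; set s := (x - c) / e.
have -> : (x \in `]c - e, c + e[%classic) = (`|s| < 1).
  rewrite -[RHS]orbF -[LHS]orbF mem_setE in_itv/=.
  by rewrite normrM normfV (gtr0_norm e0) ltr_pdivrMr// mul1r -ltr_distlC distrC.
have [s1|s1] := ltP `|s| 1.
  rewrite [X in _ --> X](_ : _ = (1 + 0)^-1); last by rewrite addr0 invr1.
  apply: cvgV; first by rewrite addr0 oner_neq0.
  apply: cvgD; first exact: cvg_cst.
  rewrite -(real_normK (num_real s)).
  by apply: cvg_natM_expr_sqr; rewrite normr_ge0.
(* The factor n in the denominator serves the endpoints |s| = 1: the powers stay equal to 1 there,
   yet the inverse still tends to 0, as for an open interval. *)
have g1 n : 1 <= (s ^+ 2) ^+ n.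
  by rewrite exprn_ege1// -(real_normK (num_real s)) exprn_ege1.
apply: (@squeeze_cvgr _ _ _ _ (fun=> 0) (fun n => n.+1%:R^-1)).
- near=> n.
  have n0 : 0 <= n%:R * (s ^+ 2) ^+ n by rewrite mulr_ge0// (le_trans ler01).
  rewrite invr_ge0 addr_ge0//= lef_pV2 ?posrE ?ltr0n//; last exact: ltr_pwDl.
  by rewrite -nat1r lerD2l ler_peMr.
- exact: cvg_cst.
- exact: cvg_harmonic.
Unshelve. all: by end_near. Qed.

(** * Functional calculus of a symmetric matrix *)

Section functional_calculus.
Context {R : realType} {N : nat} (A : 'M[R]_N).
Hypothesis symA : A^T = A.
Variable rs : seq R.
Let P := eigenprojection A.
Hypothesis sumP : \sum_(r <- rs) P r = 1%:M.
Hypothesis urs : uniq rs.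

Definition spectral_sum (f : R -> R) : 'M[R]_N := \sum_(r <- rs) f r *: P r.

Lemma spectral_sum_id : spectral_sum id = A.
Proof.
rewrite -[RHS]mul1mx -sumP mulmx_suml; apply: eq_bigr => r _.
by rewrite /P eigenprojectionl.
Qed.

Lemma spectral_sum_cst k : spectral_sum (fun=> k) = k%:M.
Proof. by rewrite -scalemx1 -sumP scaler_sumr. Qed.

Lemma spectral_sumD f g :
  spectral_sum (fun r => f r + g r) = spectral_sum f + spectral_sum g.
Proof. by rewrite -big_split; apply: eq_bigr => r _; rewrite scalerDl. Qed.

Lemma spectral_sumZ k f :
  spectral_sum (fun r => k * f r) = k *: spectral_sum f.
Proof. by rewrite scaler_sumr; apply: eq_bigr => r _; rewrite scalerA. Qed.

Lemma spectral_sumM f g :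
  spectral_sum (fun r => f r * g r) = spectral_sum f *m spectral_sum g.
Proof.
rewrite mulmx_suml; apply: eq_big_seq => r rrs.
rewrite mulmx_sumr (bigD1_seq r)//= big1 ?addr0.
  by rewrite -scalemxAl -scalemxAr (eigenprojectionM symA) eqxx scale1r scalerA.
move=> s sr; rewrite -scalemxAl -scalemxAr (eigenprojectionM symA).
by rewrite eq_sym (negbTE sr) scale0r !scaler0.
Qed.

Lemma spectral_sumX f k :
  spectral_sum (fun r => f r ^+ k) = spectral_sum f ^+ k.
Proof.
elim: k => [|k ih].
  by rewrite expr0 -[RHS]spectral_sum_cst.
under [X in spectral_sum X]eq_fun do rewrite exprS.
by rewrite spectral_sumM ih exprS.
Qed.

Lemma spectral_sumV f : (forall r, f r != 0) ->
  spectral_sum f \in unitmx /\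
  invmx (spectral_sum f) = spectral_sum (fun r => (f r)^-1).
Proof.
move=> f0.
have h : spectral_sum f *m spectral_sum (fun r => (f r)^-1) = 1%:M.
  rewrite -spectral_sumM -[RHS]spectral_sum_cst; congr spectral_sum.
  by apply/funext => r; rewrite divff.
have [u _] := mulmx1_unit h; split => //.
by rewrite -[LHS]mulmx1 -h mulKmx.
Qed.

Lemma spectral_sum_cvg (h : nat -> R -> R) (k : R -> R) i j :
  (forall r, h n r @[n --> \oo] --> k r) ->
  (spectral_sum (h n) i j) @[n --> \oo] --> spectral_sum k i j.
Proof.
move=> hk; rewrite /spectral_sum summxE; under eq_fun do rewrite summxE.
apply: (@cvg_big _ _ +%R) => [|r _].
  by apply: add_continuous.
by under eq_fun do rewrite mxE; rewrite mxE; apply: cvgM; [exact: hk|exact: cvg_cst].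
Qed.

Lemma spectral_measure_sum B :
  spectral_measure A B = \sum_(r <- rs | r \in B) P r ->
  spectral_measure A B = spectral_sum (fun r => (r \in B)%:R).
Proof.
move=> ->; rewrite big_mkcond; apply: eq_bigr => r _.
by case: ifP => _; rewrite ?scale1r ?scale0r.
Qed.

End functional_calculus.

Lemma spectral_measure_cvg (R : realType) (N : nat) (A : 'M[R]_N)
    (B : nat -> set R) (C : set R) i j : A^T = A ->
  (forall x, ((x \in B n)%:R : R) @[n --> \oo] --> ((x \in C)%:R : R)) ->
  spectral_measure A (B n) i j @[n --> \oo] --> spectral_measure A C i j.
Proof.
move=> symA BC; have [rs [urs sumP _ _ smE]] := spectral_resolution symA.
rewrite (spectral_measure_sum (smE C)).
under eq_fun do rewrite (spectral_measure_sum (smE _)).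
exact: spectral_sum_cvg.
Qed.

(** [M n] is f_n(A) for the denominators f_n of [cvg_indicator_ball]. Being expressed by ring
    operations on [A], it avoids the eigenvalues, which is what measurability in a random parameter
    requires. *)
Lemma spectral_measure_ball_cvg (R : realType) (N : nat) (A : 'M[R]_N) (c e : R)
    (M := fun n => 1%:M + n%:R *: ((e^-1 *: (A - c%:M)) ^+ 2) ^+ n) :
  A^T = A -> 0 < e ->
  (forall n, M n \in unitmx) /\ forall i j, invmx (M n) i j @[n --> \oo] -->
    spectral_measure A `]c - e, c + e[%classic i j.
Proof.
move=> symA e0; have [rs [urs sumP _ _ smE]] := spectral_resolution symA.
pose f n x := 1 + n%:R * (((x - c) / e) ^+ 2) ^+ n.
have ME n : M n = spectral_sum A rs (f n).
  rewrite /M /f spectral_sumD (spectral_sum_cst sumP) spectral_sumZ.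
  rewrite !(spectral_sumX symA sumP urs).
  under [X in spectral_sum _ _ X]eq_fun do rewrite mulrC.
  rewrite spectral_sumZ spectral_sumD.
  by rewrite (spectral_sum_cst sumP) spectral_sum_id// raddfN.
have f0 n x : f n x != 0.
  rewrite gt_eqF// /f ltr_pwDl// mulr_ge0//.
  by rewrite exprn_ge0// sqr_ge0.
split=> [n|i j].
  by rewrite ME; have [] := spectral_sumV symA sumP urs (f0 n).
under eq_fun do rewrite ME (spectral_sumV symA sumP urs (f0 _)).2.
rewrite (spectral_measure_sum (smE _)).
by apply: spectral_sum_cvg => r; exact: cvg_indicator_ball.
Qed.

Lemma spectral_measureT (R : realType) (N : nat) (A : 'M[R]_N) : A^T = A ->
  spectral_measure A setT = 1%:M.
Proof.
move=> symA; have [rs [_ sumP _ _ ->]] := spectral_resolution symA.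
by rewrite -sumP; apply: eq_bigl => r; rewrite in_setT.
Qed.

Lemma spectral_measure0 (R : realType) (N : nat) (A : 'M[R]_N) : A^T = A ->
  spectral_measure A set0 = 0.
Proof.
move=> symA; have [rs [_ sumP _ _ ->]] := spectral_resolution symA.
by rewrite big1// => r; rewrite in_set0.
Qed.

Lemma spectral_measureC (R : realType) (N : nat) (A : 'M[R]_N) (B : set R) :
  A^T = A -> spectral_measure A (~` B) = 1%:M - spectral_measure A B.
Proof.
move=> symA; have [rs [_ sumP _ _ smE]] := spectral_resolution symA.
apply/eqP; rewrite eq_sym subr_eq eq_sym !smE -sumP [X in _ == X](bigID (mem B))/=.
rewrite addrC; apply/eqP; congr (_ + _).
by apply: eq_bigl => r; rewrite in_setC.
Qed.

Lemma cvg_sum_trivIset (R : realType) (F : nat -> set R) (x : R) :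
  trivIset setT F ->
  \sum_(k < n) ((x \in F k)%:R : R) @[n --> \oo] -->
  ((x \in \bigcup_k F k)%:R : R).
Proof.
move=> tF; have [[k _ Fkx]|nF] := pselect ((\bigcup_k F k) x); last first.
  rewrite memNset//; apply: cvg_near_cst; near=> n.
  by rewrite big1// => k _; rewrite memNset// => Fkx; apply: nF; exists k.
rewrite mem_set; last by exists k.
apply: cvg_near_cst; near=> n.
have kn : (k < n)%N by near: n; exists k.+1.
rewrite (bigD1 (Ordinal kn))//= mem_set// big1 ?addr0// => l lk.
rewrite memNset// => Flx; case/eqP: lk; apply/val_inj => /=.
by apply: tF => //; exists x.
Unshelve. all: by end_near. Qed.

Lemma spectral_measure_bigcup (R : realType) (N : nat) (A : 'M[R]_N)
    (F : nat -> set R) i j : A^T = A -> trivIset setT F ->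
  \sum_(k < n) spectral_measure A (F k) i j @[n --> \oo] -->
  spectral_measure A (\bigcup_k F k) i j.
Proof.
move=> symA tF; have [rs [_ sumP _ _ smE]] := spectral_resolution symA.
rewrite (spectral_measure_sum (smE _)).
have -> : (fun n => \sum_(k < n) spectral_measure A (F k) i j) = (fun n =>
    spectral_sum A rs (fun r => \sum_(k < n) (r \in F k)%:R) i j).
  apply/funext => n; rewrite /spectral_sum.
  under [in RHS]eq_bigr do rewrite scaler_suml.
  rewrite exchange_big/= summxE; apply: eq_bigr => k _.
  by rewrite (spectral_measure_sum (smE _)).
by apply: spectral_sum_cvg => r; exact: cvg_sum_trivIset.
Qed.

Section measurable_spectral_measure.
Context {d : measure_display} {T : measurableType d} {R : realType} {N : nat}.
Variable A : T -> 'M[R]_N.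
Hypotheses (symA : forall w, (A w)^T = A w) (mA : measurable_mx A).
Variables (i j : 'I_N).

Let sm B := measurable_fun setT (fun w => spectral_measure (A w) B i j).

Lemma measurable_spectral_measure_ball (c e : R) : 0 < e ->
  sm `]c - e, c + e[%classic.
Proof.
move=> e0.
apply: (measurable_fun_cvg (h := fun n w => invmx
   (1%:M + n%:R *: ((e^-1 *: (A w - c%:M)) ^+ 2) ^+ n) i j)) => [n|w _].
- apply: measurable_invmx => [w|].
    by have [] := @spectral_measure_ball_cvg _ _ (A w) c e (symA w) e0.
  apply: measurable_mxD; first exact: measurable_mx_cst.
  apply/measurable_mxZ/measurable_mxX/measurable_mxX/measurable_mxZ.
  by apply: measurable_mxD => //; exact: measurable_mx_cst.
- by have [_] := @spectral_measure_ball_cvg _ _ (A w) c e (symA w) e0; exact.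
Qed.

(** Dynkin's lemma on the open half-lines, a pi-system generating the Borel sets: complements and
    disjoint unions become differences and series of entries. *)
Lemma measurable_spectral_measure (B : set R) : measurable B -> sm B.
Proof.
move=> mB.
have := @dynkin_induction _ (measurableTypeR R) (@RGenOInfty.G R) sm.
apply.
- exact: RGenOInfty.measurableE.
- move=> _ _ [x ->] [y ->]; exists (Num.max x y).
  by apply/seteqP; split=> z; rewrite /= !in_itv/= !andbT gt_max => /andP.
- rewrite /sm; under eq_fun do rewrite spectral_measureT//.
  exact: measurable_cst.
- move=> _ [x ->].
  (* The ball of centre x + n + 1 and radius n + 1 is ]x, x + 2n + 2[, and these exhaust the
     half-line. *)
  apply: (measurable_fun_cvg (h := fun n w => spectral_measure (A w)
    `]x + n.+1%:R - n.+1%:R, x + n.+1%:R + n.+1%:R[%classic i j)) => [n|w _].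
    exact: measurable_spectral_measure_ball.
  apply: spectral_measure_cvg => // z; apply: cvg_near_cst; near=> n.
  congr (_%:R); congr nat_of_bool; apply/idP/idP.
    by rewrite !inE/= !in_itv/= addrK andbT => /andP[].
  rewrite !inE/= !in_itv/= addrK andbT => xz; rewrite xz/=.
  apply: (@lt_trans _ _ (x + n.+1%:R)); last by rewrite ltrDl.
  rewrite -ltrBlDl; apply: (@lt_trans _ _ n%:R); last by rewrite ltr_nat.
  near: n; exact: nbhs_infty_gtr.
- move=> S mS smS; rewrite /sm.
  under eq_fun do rewrite spectral_measureC// mxE [X in _ + X]mxE.
  by apply: measurable_funB => //; exact: measurable_cst.
- move=> F mF tF smF.
  apply: (measurable_fun_cvg
    (h := fun n w => \sum_(k < n) spectral_measure (A w) (F k) i j)) => [n|w _].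
    by apply: measurable_sum => k; exact: smF.
  exact: spectral_measure_bigcup.
- have : (@RGenOInfty.G R).-sigma.-measurable B by rewrite -RGenOInfty.measurableE.
  by [].
Unshelve. all: by end_near. Qed.

End measurable_spectral_measure.

(** Bundles a set function while keeping its values; it also carries the Lebesgue-Stieltjes measure
    from [measurableTypeR R] to [R]. *)
Lemma measure_of_set_fun (d : measure_display) (T : measurableType d)
    (R : realType) (mu : set T -> \bar R) :
  mu set0 = 0%E -> (forall B, 0 <= mu B)%E -> semi_sigma_additive mu ->
  exists m : {measure set T -> \bar R}, forall B, m B = mu B.
Proof.
move=> mu0 mu_ge0 mus.
pose m : {measure set T -> \bar R} := HB.pack mu
  (isMeasure.Build _ _ _ mu mu0 mu_ge0 mus).
by exists m.
Qed.

Section eigenprojection_diagonal.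
Context {R : realType} {N : nat} (A : 'M[R]_N).
Hypothesis symA : A^T = A.

(** A symmetric idempotent is its own Gram matrix; all positivity and monotonicity of diagonal
    entries rests on this. *)
Lemma eigenprojection_diagE r i :
  eigenprojection A r i i = \sum_j eigenprojection A r i j ^+ 2.
Proof.
have [rs [_ _ _ trP _]] := spectral_resolution symA.
have := eigenprojectionM symA r r; rewrite eqxx scale1r => {1}<-.
rewrite mxE; apply: eq_bigr => j _.
have /matrixP/(_ i j) := trP r; rewrite mxE => ->; rewrite expr2. done.
Qed.

Lemma eigenprojection_diag_ge0 r i : 0 <= eigenprojection A r i i.
Proof.
by rewrite eigenprojection_diagE; apply: sumr_ge0 => j _; exact: sqr_ge0.
Qed.

Lemma le_spectral_measure B C i : B `<=` C ->
  spectral_measure A B i i <= spectral_measure A C i i.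
Proof.
move=> BC; have [rs [_ _ _ _ smE]] := spectral_resolution symA.
rewrite !smE !summxE big_mkcond [leRHS]big_mkcond/=; apply: ler_sum => r _.
case: ifPn => [rB|_]; first by rewrite mem_set//; apply/BC/set_mem.
by case: ifPn => // _; exact: eigenprojection_diag_ge0.
Qed.

Lemma spectral_measure_ge0 B i : 0 <= spectral_measure A B i i.
Proof.
have {1}<- : spectral_measure A set0 i i = 0 by rewrite spectral_measure0// mxE.
exact: le_spectral_measure.
Qed.

Lemma spectral_measure_le1 B i : spectral_measure A B i i <= 1.
Proof.
have <- : spectral_measure A setT i i = 1.
  by rewrite spectral_measureT// mxE eqxx.
exact: le_spectral_measure.
Qed.

End eigenprojection_diagonal.

Section mean_spectral_measure.
Context {d : measure_display} {T : measurableType d} {R : realType}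
  (P : probability T R) {N : nat}.
Variable A : T -> 'M[R]_N.
Hypotheses (symA : forall w, (A w)^T = A w) (mA : measurable_mx A).
Variable i : 'I_N.

(** Countable additivity survives the expectation because diagonal entries are nonnegative and
    measurable, so series and integral commute. *)
Lemma mean_spectral_measure :
  exists m : {measure set R -> \bar R},
    forall B, m B = 'E_P[fun w => spectral_measure (A w) B i i]%E.
Proof.
pose mu (B : set R) := (\int[P]_w (spectral_measure (A w) B i i)%:E)%E.
suff [m mE] : exists m : {measure set R -> \bar R}, forall B, m B = mu B.
  by exists m => B; rewrite mE unlock.
apply: measure_of_set_fun => [|B|F mF tF mUF]; rewrite /mu.
- under eq_integral do rewrite spectral_measure0// mxE.
  exact: integral0.
- apply: integral_ge0 => w _; rewrite lee_fin.
  exact: spectral_measure_ge0.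
have -> : (\int[P]_w (spectral_measure (A w) (\bigcup_n F n) i i)%:E =
    \int[P]_w (\sum_(0 <= k <oo) (spectral_measure (A w) (F k) i i)%:E))%E.
  apply: eq_integral => w _; apply/esym/cvg_lim => //.
  under eq_fun do rewrite sumEFin big_mkord.
  by apply: cvg_EFin; [exact: nearW|exact: spectral_measure_bigcup].
rewrite integral_nneseries//.
- apply: is_cvg_nneseries => n _ _; apply: integral_ge0 => w _.
  by rewrite lee_fin spectral_measure_ge0.
- by move=> n; apply/measurable_EFinP; exact: measurable_spectral_measure.
- by move=> n w _; rewrite lee_fin spectral_measure_ge0.
Qed.

End mean_spectral_measure.

(** * Perturbation of a diagonal matrix *)

Section eigenprojection_sums.
Context {R : realType} {N : nat} (A : 'M[R]_N).
Hypothesis symA : A^T = A.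
Variable rs : seq R.
Let P := eigenprojection A.
Hypothesis sumP : \sum_(r <- rs) P r = 1%:M.
Hypothesis trP : forall r, (P r)^T = P r.
Hypothesis smE : forall B, spectral_measure A B = \sum_(r <- rs | r \in B) P r.

(** Cauchy-Schwarz with weights |D i j| bounds each squared entry by K times a weighted sum; summing
    over j uses the other family of absolute sums. *)
Lemma schur_test (D : 'M[R]_N) (K : R) : 0 <= K ->
  (forall j, \sum_i `|D i j| <= K) -> (forall i, \sum_j `|D i j| <= K) ->
  forall v : 'rV[R]_N, \sum_j (v *m D) 0 j ^+ 2 <= K ^+ 2 * \sum_j v 0 j ^+ 2.
Proof.
move=> K0 Dc Dr v.
have step j : (v *m D) 0 j ^+ 2 <= K * \sum_i `|D i j| * v 0 i ^+ 2.
  have cs : (\sum_i `|D i j| * `|v 0 i|) ^+ 2 <=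
      (\sum_i `|D i j|) * \sum_i `|D i j| * v 0 i ^+ 2.
    rewrite expr2 !mulr_suml.
    under eq_bigr do rewrite mulr_sumr.
    under [leRHS]eq_bigr do rewrite mulr_sumr.
    set F := fun i k => `|D i j| * (`|D k j| * v 0 k ^+ 2).
    (* After symmetrising the double sum in i and k, the inequality holds term by term: it is a b (x
       - y)^2 >= 0. *)
    have E : \sum_i \sum_k F i k =
        \sum_i \sum_k (F i k + F k i) / 2.
      transitivity ((\sum_i \sum_k F i k + \sum_i \sum_k F k i) / 2).
        rewrite [X in _ + X]exchange_big/=; lra.
      rewrite -big_split/= mulr_suml; apply: eq_bigr => i _.
      by rewrite -big_split/= mulr_suml.
    rewrite [leRHS]E; apply: ler_sum => i _; apply: ler_sum => k _.
    rewrite /F -(real_normK (num_real (v 0 k))) -(real_normK (num_real (v 0 i))).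
    set a := `|D i j|; set b := `|D k j|; set x := `|v 0 i|; set y := `|v 0 k|.
    have ab0 : 0 <= a * b by rewrite mulr_ge0 ?normr_ge0.
    have := mulr_ge0 ab0 (sqr_ge0 (x - y)).
    nra.
  have le1 : (v *m D) 0 j ^+ 2 <= (\sum_i `|D i j| * `|v 0 i|) ^+ 2.
    rewrite -(real_normK (num_real ((v *m D) 0 j))) lerXn2r ?nnegrE//.
      by apply: sumr_ge0 => i _; rewrite mulr_ge0.
    rewrite mxE (le_trans (ler_norm_sum _ _ _))//.
    by apply: ler_sum => i _; rewrite normrM mulrC.
  apply: (le_trans le1); apply: (le_trans cs); apply: ler_wpM2r (Dc j).
  by apply: sumr_ge0 => i _; rewrite mulr_ge0// sqr_ge0.
apply: (le_trans (ler_sum _ (fun j _ => step j))).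
rewrite -mulr_sumr expr2 -mulrA; apply: ler_wpM2l => //.
rewrite exchange_big mulr_sumr; apply: ler_sum => i _ /=.
by rewrite -mulr_suml; apply: ler_wpM2r; [exact: sqr_ge0|exact: Dr].
Qed.

Section perturbation.
Variables (D : 'M[R]_N) (V : 'I_N -> R) (K : R).
Hypothesis AE : A = D + diag_mx (\row_i V i).
Hypothesis K0 : 0 <= K.
Hypotheses (Dc : forall j, \sum_i `|D i j| <= K).
Hypotheses (Dr : forall i, \sum_j `|D i j| <= K).

Lemma eigenprojection_perturbation r i j :
  (P r *m D) i j = (r - V j) * P r i j.
Proof.
have /matrixP/(_ i j) := eigenprojectionl A r.
have -> : eigenprojection A r *m A = P r *m (D + diag_mx (\row_i V i)).
  by rewrite -AE.
rewrite mulmxDr mxE [in RHS]mxE -/P mul_mx_diag.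
set x := (P r *m D) i j; rewrite !mxE; lra.
Qed.

(** The left side is the squared Hilbert-Schmidt norm of P_r D = P_r (r - V); Schur's test bounds it
    row by row. *)
Lemma sum_sqr_perturbation r :
  \sum_j (r - V j) ^+ 2 * P r j j <= K ^+ 2 * \tr (P r).
Proof.
have -> : \sum_j (r - V j) ^+ 2 * P r j j = \sum_i \sum_j (row i (P r) *m D) 0 j ^+ 2.
  rewrite exchange_big; apply: eq_bigr => j _.
  rewrite (eigenprojection_diagE symA) mulr_sumr; apply: eq_bigr => i _.
  rewrite -row_mul [in RHS]mxE eigenprojection_perturbation exprMn.
  by have /matrixP/(_ i j) := trP r; rewrite mxE => ->.
rewrite /mxtrace mulr_sumr; apply: ler_sum => i _.
apply: (le_trans (schur_test K0 Dc Dr _)); rewrite (eigenprojection_diagE symA).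
by apply: ler_wpM2l; [exact: sqr_ge0|apply: ler_sum => j _; rewrite mxE].
Qed.

(* Far from the spectrum of [D], eigenvectors carry a fixed fraction of their
   mass on the sites where the potential is large. *)
Lemma trace_far_spectral_measure (e : R) : 0 < e ->
  ((K + e) ^+ 2 - K ^+ 2) * \tr (spectral_measure A [set r | K + e + e <= `|r|])
  <= (K + e) ^+ 2 * \sum_j (e <= `|V j|)%R%:R.
Proof.
move=> e0; set S := [set r | _].
have far r : r \in S -> ((K + e) ^+ 2 - K ^+ 2) * \tr (P r) <=
    (K + e) ^+ 2 * \sum_j (e <= `|V j|)%R%:R * P r j j.
  move=> /set_mem rS; have {}rS : K + e + e <= `|r| by [].
  (* A site with |V_j| < e has |r - V_j| >= K + e, since |r| >= K + 2e; the other sites are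
     dropped. *)
  have h : (K + e) ^+ 2 * \sum_j (1 - (e <= `|V j|)%R%:R) * P r j j <= K ^+ 2 * \tr (P r).
    apply: (le_trans _ (sum_sqr_perturbation r)).
    rewrite mulr_sumr; apply: ler_sum => j _; rewrite mulrA.
    apply: ler_wpM2r; first exact: (eigenprojection_diag_ge0 symA).
    have [eV|Ve] := leP e `|V j|; first by rewrite subrr mulr0 sqr_ge0.
    rewrite subr0 mulr1 -(real_normK (num_real (r - V j))) lerXn2r ?nnegrE//.
      by rewrite addr_ge0// ltW.
    have := lerB_dist r (V j). lra.
  have : \sum_j (1 - (e <= `|V j|)%R%:R) * P r j j =
      \tr (P r) - \sum_j (e <= `|V j|)%R%:R * P r j j.
    by rewrite -sumrB; apply: eq_bigr => j _; rewrite mulrBl mul1r.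
  move=> E; rewrite E in h; lra.
(* Summed over r in [S], the weights at a site total at most 1, which turns the right side into a
   count of sites. *)
have PS j : 0 <= spectral_measure A S j j <= 1.
  by rewrite (spectral_measure_ge0 symA) (spectral_measure_le1 symA).
apply: (@le_trans _ _ ((K + e) ^+ 2 *
    \sum_j (e <= `|V j|)%R%:R * spectral_measure A S j j)); last first.
  apply: ler_wpM2l; first exact: sqr_ge0.
  apply: ler_sum => j _; case/andP: (PS j) => _ p1.
  by case: (e <= _)%R; rewrite ?mul1r// mul0r.
rewrite smE raddf_sum/= mulr_sumr.
apply: (le_trans (ler_sum _ far)).
rewrite -mulr_sumr exchange_big/=.
apply: ler_wpM2l; first exact: sqr_ge0.
by apply: ler_sum => j _; rewrite summxE mulr_sumr.
Qed.

(* Chebyshev's inequality for the spectral measure of [A] at site [n], whose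
   second moment about [V n] is the squared norm of the [n]-th column of [D]. *)
Lemma spectral_measure_near_potential n : 0 < K ->
  2 * \sum_j D j n ^+ 2 <= K ^+ 2 ->
  1 / 2 <= spectral_measure A [set r | `|r - V n| <= K] n n.
Proof.
move=> K_gt0 DK; set S := [set r | _].
have moment : \sum_(r <- rs) (r - V n) ^+ 2 * P r n n = \sum_j D j n ^+ 2.
  transitivity ((D^T *m D) n n); last first.
    by rewrite mxE; apply: eq_bigr => j _; rewrite mxE expr2.
  have E : D = \sum_(r <- rs) P r *m D by rewrite -mulmx_suml sumP mul1mx.
  rewrite {2}E mulmx_sumr summxE.
  apply: eq_bigr => r _.
  have -> : D^T *m (P r *m D) = (P r *m D)^T *m (P r *m D).
    have PP : P r *m P r = P r by rewrite /P (eigenprojectionM symA) eqxx scale1r.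
    by rewrite trmx_mul trP -[RHS](mulmxA D^T (P r)) (mulmxA (P r) (P r)) PP.
  rewrite [RHS]mxE (eigenprojection_diagE symA) mulr_sumr.
  apply: eq_bigr => i _; rewrite [(_^T) _ _]mxE eigenprojection_perturbation.
  have /matrixP/(_ i n) := trP r; rewrite [(_^T) _ _]mxE => <-; rewrite -/P; lra.
have tail : 1 - spectral_measure A S n n <= (K ^+ 2)^-1 * \sum_j D j n ^+ 2.
  have := spectral_measureC S symA => /matrixP/(_ n n).
  rewrite [RHS]mxE mxE eqxx [X in _ = _ + X]mxE => <-.
  rewrite smE summxE -moment mulr_sumr big_mkcond; apply: ler_sum => r _.
  have Pr0 : 0 <= P r n n by exact: (eigenprojection_diag_ge0 symA).
  case: ifPn => [/set_mem/= /negP|_]; last first.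
    by rewrite mulr_ge0 ?invr_ge0 ?sqr_ge0// mulr_ge0 ?sqr_ge0.
  rewrite -ltNge => Kr; rewrite mulrA ler_peMl// mulrC ler_pdivlMr ?exprn_gt0//.
  rewrite mul1r -(real_normK (num_real (r - V n))) lerXn2r ?nnegrE//.
  exact: ltW.
have : (K ^+ 2)^-1 * \sum_j D j n ^+ 2 <= 1 / 2.
  rewrite mulrC ler_pdivrMr ?exprn_gt0//; lra.
lra.
Qed.

End perturbation.
End eigenprojection_sums.

(** * The Hamiltonian in a box *)

Section box_hamiltonian.
Context {R : realType} {d : nat}.
Implicit Types n m : 'rV[int]_d.

Definition adjacency (L : nat) : 'M[R]_(Lambda_card d L) :=
  \matrix_(i, j) (Lambda_site j \in neighbours R (Lambda_site i))%:R.

Lemma enormN n : enorm R (- n) = enorm R n.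
Proof.
by rewrite /enorm; congr Num.sqrt; apply: eq_bigr => i _; rewrite mxE intrN sqrrN.
Qed.

Lemma neighbours_sym n m : (m \in neighbours R n) = (n \in neighbours R m).
Proof.
by apply/idP/idP => /set_mem h; apply/mem_set; move: h; rewrite /neighbours/=;
  rewrite -enormN opprB.
Qed.

(** A nonzero integer coordinate has square at least 1, so in a vector of norm 1 it exhausts the sum
    of squares. *)
Lemma neighbours_delta n m : m \in neighbours R n ->
  exists i (b : bool), m = n + (if b then 1 else -1) *: delta_mx 0 i.
Proof.
move=> /set_mem; rewrite /neighbours /enorm /= => mn.
pose k := m - n; rewrite -/k in mn.
have mE : m = n + k by rewrite /k addrC subrK.
clearbody k.
have ks : \sum_(i < d) ((k 0 i)%:~R : R) ^+ 2 = 1.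
  by rewrite -(sqr_sqrtr (sumr_ge0 _ (fun i _ => sqr_ge0 _))) mn expr1n.
have kz : \sum_(i < d) k 0 i ^+ 2 = 1.
  apply/eqP; rewrite -(eqr_int R _ 1) rmorph_sum/= -[X in _ == X]ks; apply/eqP.
  by apply: eq_bigr => i _; rewrite rmorphXn.
have [i ki] : exists i, k 0 i != 0.
  apply/existsP; apply: contraT; rewrite negb_exists => /forallP k0.
  move: kz; rewrite big1// => i _.
  by have := k0 i; rewrite negbK => /eqP ->; rewrite expr0n.
have k1 : 1 <= k 0 i ^+ 2 by rewrite -gtz0_ge1 exprn_even_gt0.
have rest : \sum_(j < d | j != i) k 0 j ^+ 2 = 0.
  apply/eqP; rewrite eq_le sumr_ge0 ?andbT; last by move=> j _; exact: sqr_ge0.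
  have -> : \sum_(j < d | j != i) k 0 j ^+ 2 = 1 - k 0 i ^+ 2.
    by move: kz; rewrite (bigD1 i)//= => e; lra.
  by rewrite subr_le0.
have ki1 : k 0 i ^+ 2 = 1 by move: kz; rewrite (bigD1 i)//= rest addr0.
exists i, (k 0 i == 1); rewrite mE; congr (_ + _).
apply/rowP => j; rewrite !mxE eqxx/=.
have [->|ji] := eqVneq j i.
  rewrite mulr1; move/eqP: ki1; rewrite sqrf_eq1.
  by case/orP => /eqP ->.
rewrite mulr0; apply/eqP; rewrite -sqrf_eq0; apply/eqP.
have /psumr_eq0P := rest; apply => // l _; exact: sqr_ge0.
Qed.

Lemma Lambda_site_inj L : injective (@Lambda_site d L).
Proof.
move=> i j /eqP; rewrite nth_uniq ?fset_uniq//; first by move/eqP/val_inj.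
Qed.

(** There are 2d candidate neighbours, and injectivity of [Lambda_site] lets each be met by at most
    one index of the box. *)
Lemma sum_adjacency L (i : 'I_(Lambda_card d L)) :
  \sum_j adjacency L i j <= 2 * d%:R.
Proof.
pose f (p : 'I_d * bool) := Lambda_site i + (if p.2 then 1 else -1) *: delta_mx 0 p.1.
apply: (@le_trans _ _ (\sum_j \sum_(p : 'I_d * bool) (Lambda_site j == f p)%:R)).
  apply: ler_sum => j _; rewrite mxE.
  case: (boolP (_ \in neighbours R _)) => [/neighbours_delta[k [b E]]|_];
    last by rewrite sumr_ge0.
  by rewrite (bigD1 (k, b))//= E eqxx lerDl sumr_ge0.
rewrite exchange_big/=.
apply: (@le_trans _ _ (\sum_(p : 'I_d * bool) (1 : R))).
  apply: ler_sum => p _.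
  have [/existsP[j /eqP jp]|] :=
    boolP [exists j : 'I_(Lambda_card d L), Lambda_site j == f p]; last first.
    rewrite negb_exists => /forallP np; rewrite big1// => j _.
    by rewrite (negbTE (np j)).
  rewrite (bigD1 j)//= jp eqxx big1 ?addr0// => l lj; rewrite -jp.
  by rewrite (inj_eq (@Lambda_site_inj L)) (negbTE lj).
by rewrite sumr_const card_prod card_ord card_bool natrM mulrC.
Qed.

Lemma adjacency_sym L : (adjacency L)^T = adjacency L.
Proof. by apply/matrixP => i j; rewrite !mxE neighbours_sym. Qed.

Lemma hamiltonian_boxE (a q : 'rV[int]_d -> R) L :
  hamiltonian_box a q L =
  - adjacency L + diag_mx (\row_i (a (Lambda_site i) * q (Lambda_site i))).
Proof.
apply/matrixP => i j; rewrite !mxE /hamiltonian /laplacian /potential.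
congr (- _ + _); last first.
  rewrite /basis_vector (inj_eq (@Lambda_site_inj L)).
  by case: eqVneq => [->|]; rewrite ?mulr1 ?mulr0.
rewrite /basis_vector; case: (boolP (_ \in neighbours R _)) => [jn|/negP jn].
  rewrite (fsbigD1 (Lambda_site j))/=; [|exact: finite_neighbours|exact: set_mem].
  by rewrite eqxx fsbig1 ?addr0// => m [_ /eqP/negbTE ->].
rewrite fsbig1// => m mn; case: eqP => // mj.
by case: jn; rewrite -mj; exact: mem_set.
Qed.

Lemma hamiltonian_box_sym (a q : 'rV[int]_d -> R) L :
  (hamiltonian_box a q L)^T = hamiltonian_box a q L.
Proof.
by rewrite hamiltonian_boxE linearD/= linearN/= adjacency_sym tr_diag_mx.
Qed.

End box_hamiltonian.

(** * The power law *)

Section power_density.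
Context {R : realType} (delta : R).

Lemma continuous_powR (p x : R) : 0 < x -> {for x, continuous (fun y => y `^ p)}.
Proof.
move=> x0; apply/differentiable_continuous/derivable1_diffP.
by have h := @is_derive1_powR R p x x0; exact: ex_derive.
Qed.

Lemma integral_power_density (s t : R) : 0 < s -> s < t ->
  (\int[lebesgue_measure]_(x in `[s, t])
      ((delta - 1) / 2 * x `^ (- delta))%:E =
   (2^-1 * (s `^ (1 - delta) - t `^ (1 - delta)))%:E)%E.
Proof.
move=> s0 st.
pose F x := - (2^-1) * x `^ (1 - delta).
pose f x := (delta - 1) / 2 * x `^ (- delta).
have dF (x : R) : 0 < x -> is_derive x 1 F (f x).
  move=> x0; apply: is_derive_eq.
    apply: is_deriveM; exact: is_derive1_powR.
  rewrite /f (_ : 1 - delta - 1 = - delta); last by ring.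
  by rewrite scaler0 addr0 /GRing.scale/=; ring.
have cf (x : R) : 0 < x -> {for x, continuous f}.
  move=> x0; apply: (@cvgM _ _ _ _ _ _ _ _ (cvg_cst _)).
  exact: continuous_powR.
have cF (x : R) : 0 < x -> {for x, continuous F}.
  move=> x0; apply: (@cvgM _ _ _ _ _ _ _ _ (cvg_cst _)).
  exact: continuous_powR.
have -> : 2^-1 * (s `^ (1 - delta) - t `^ (1 - delta)) = F t - F s.
  by rewrite /F; ring.
rewrite (@continuous_FTC2 _ f F s t) ?EFinB//.
- apply: continuous_in_subspaceT => x /set_mem/=; rewrite in_itv/= => /andP[sx _].
  exact: cf (lt_le_trans s0 sx).
- split.
  + move=> x; rewrite in_itv/= => /andP[sx _].
    exact: (@ex_derive _ _ _ _ _ _ _ (dF x (lt_trans s0 sx))).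
  + exact: cvg_at_right_filter (cF s s0).
  + exact: cvg_at_left_filter (cF t (lt_trans s0 st)).
- move=> x; rewrite in_itv/= => /andP[sx _].
  by rewrite derive1E; exact: (@derive_val _ _ _ _ _ _ _ (dF x (lt_trans s0 sx))).
Qed.

Lemma integral_rho (s t : R) : 1 <= s -> s < t ->
  (\int[lebesgue_measure]_(x in `[s, t]) (rho delta x)%:E =
   (2^-1 * (s `^ (1 - delta) - t `^ (1 - delta)))%:E)%E.
Proof.
move=> s1 st; have s0 : 0 < s := lt_le_trans ltr01 s1.
rewrite -integral_power_density//; apply: eq_integral => x /set_mem/=.
rewrite in_itv/= => /andP[sx _]; have x1 := le_trans s1 sx.
by rewrite /rho (ger0_norm (le_trans ler01 x1)) ltNge x1.
Qed.

Lemma integral_rhoN (s t : R) : 1 <= s -> s < t ->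
  (\int[lebesgue_measure]_(x in `[(- t)%R, (- s)%R]) (rho delta x)%:E =
   (2^-1 * (s `^ (1 - delta) - t `^ (1 - delta)))%:E)%E.
Proof.
move=> s1 st; have s0 : 0 < s := lt_le_trans ltr01 s1.
pose g (x : R) := (delta - 1) / 2 * (- x) `^ (- delta).
transitivity (\int[lebesgue_measure]_(x in `[(- t)%R, (- s)%R]) (g x)%:E)%E.
  apply: eq_integral => x /set_mem/=; rewrite in_itv/= => /andP[_ xs].
  have x1 : 1 <= - x by rewrite (le_trans s1)// lerNr.
  by rewrite /rho -normrN (ger0_norm (le_trans ler01 x1)) ltNge x1.
rewrite integration_by_substitution_oppr; last 2 first.
- exact: ltW.
- apply: continuous_in_subspaceT => x /set_mem/=; rewrite in_itv/= => /andP[_ xs].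
  have x0 : 0 < - x by rewrite (lt_le_trans s0)// lerNr.
  apply: (@cvgM _ _ _ _ _ _ _ _ (cvg_cst _)).
  apply: (@continuous_comp _ _ _ -%R (fun y => y `^ (- delta))).
    exact: opp_continuous.
  exact: continuous_powR.
rewrite -integral_power_density//; apply: eq_integral => x _.
by rewrite /g/= opprK.
Qed.

End power_density.

Section power_law.
Context {d : measure_display} {T : measurableType d} {R : realType}
  (P : probability T R) (X : {RV P >-> R}) (delta : R).
Hypotheses (hdelta : 1 < delta) (hX : has_density X (rho delta)).

Lemma power_law_itv (s t : R) : 1 <= s -> s < t ->
  P (X @^-1` `[s, t]) = (2^-1 * (s `^ (1 - delta) - t `^ (1 - delta)))%:E.
Proof.
move=> s1 st; rewrite -integral_rho// -hX//.
Qed.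

Lemma power_law_itvN (s t : R) : 1 <= s -> s < t ->
  P (X @^-1` `[- t, - s]) = (2^-1 * (s `^ (1 - delta) - t `^ (1 - delta)))%:E.
Proof.
move=> s1 st; rewrite -integral_rhoN// -hX//.
Qed.

Lemma measurable_norm_ge (t : R) : measurable [set w | t <= `|X w|].
Proof.
rewrite [X in measurable X](_ : _ = (fun w => `|X w|) @^-1` `[t, +oo[); last first.
  by apply/seteqP; split => w /=; rewrite in_itv/= andbT.
rewrite -[X in measurable X]setTI; 
have mX : measurable_fun setT (fun w => `|X w|) by apply: measurableT_comp.
by apply: mX => //; exact: measurable_itv.
Qed.

(** With u = t / 2 > 1, the event avoids the segments [1, u] and [-u, -1], of total probability 1 -
    u^(1 - delta). Halving t costs a constant factor but keeps all integrals on segments and the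
    sets disjoint. For t <= 2 the bound is at least 1. *)
Lemma power_law_tail (t : R) : 0 < t ->
  (P [set w | (t <= `|X w|)%R] <= ((t / 2) `^ (1 - delta))%:E)%E.
Proof.
move=> t0; have one p : (1 : R) `^ p = 1 by rewrite powR1.
have [t2|t2] := leP t 2.
  apply: (le_trans (probability_le1 _ (measurable_norm_ge t))).
  rewrite lee_fin -(opprB delta) powRN invf_ge1 ?powR_gt0 ?divr_gt0//.
  rewrite -[leRHS](one (delta - 1)); apply: ge0_ler_powR.
  - by rewrite subr_ge0 ltW.
  - by rewrite nnegrE divr_ge0// ltW.
  - by rewrite nnegrE.
  - by rewrite ler_pdivrMr// mul1r.
set u := t / 2; have tE : t = u + u by rewrite /u; lra.
have u1 : 1 < u by rewrite ltr_pdivlMr// mul1r.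
pose A := X @^-1` `[1, u]; pose B := X @^-1` `[- u, - 1].
have mX (C : set R) : measurable C -> measurable (X @^-1` C).
  by move=> mC; rewrite -[X in measurable X]setTI; exact: measurable_funPT.
have mA : measurable A by exact: mX.
have mB : measurable B by exact: mX.
have AB : A `&` B = set0.
  rewrite -subset0 => w []; rewrite /A /B/= !in_itv/= => /andP[h1 _] /andP[_ h2].
  lra.
have AC : [set w | t <= `|X w|] `<=` ~` (A `|` B).
  move=> w /= tw; rewrite /A /B/= !in_itv/= => -[|] /andP[h1 h2].
    by move: tw; rewrite ger0_norm; lra.
  by move: tw; rewrite ler0_norm; lra.
have PAB : P (A `|` B) = (1 - u `^ (1 - delta))%:E.
  have -> : P (A `|` B) = (P A + P B)%E by exact: measureU.
  rewrite /A /B power_law_itv// power_law_itvN// one -EFinD; congr EFin; lra.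
have le1 : (P [set w | (t <= `|X w|)%R] <= P (~` (A `|` B)))%E.
  apply: le_measure AC; rewrite inE.
    exact: measurable_norm_ge.
  by apply: measurableC; exact: measurableU.
apply: (le_trans le1); rewrite probability_setC; last exact: measurableU.
by rewrite PAB -EFinB lee_fin; lra.
Qed.

End power_law.

(** * Uniform bounds on the density of states *)

Lemma measurable_set_norm_ge (R : realType) (c : R) :
  measurable [set r : R | c <= `|r|].
Proof.
have : measurable_fun setT (fun x : R => `|x|) by [].
move=> /(_ measurableT `[c, +oo[%classic (measurable_itv _)).
rewrite setTI; congr measurable.
by apply/seteqP; split => r /=; rewrite in_itv/= andbT.
Qed.

Section density_of_states.
Context {disp : measure_display} {Omega : measurableType disp} {R : realType}
  (P : probability Omega R) {d : nat}.
Variables (a : 'rV[int]_d -> R) (q : 'rV[int]_d -> {RV P >-> R}) (delta : R).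
Hypotheses (ha : forall n, 0 < a n).

Let H L w := hamiltonian_box a (fun n => q n w) L.
Let V L w (i : 'I_(Lambda_card d L)) := a (Lambda_site i) * q (Lambda_site i) w.

Lemma measurable_hamiltonian_box L : measurable_mx (H L).
Proof.
move=> i j; under eq_fun do rewrite /H hamiltonian_boxE mxE.
apply: measurable_funD; first exact: measurable_cst.
under eq_fun do rewrite !mxE.
have [_|_] := eqVneq i j; last first.
  by under eq_fun do rewrite mulr0n; exact: measurable_cst.
under eq_fun do rewrite mulr1n.
by apply: measurable_funM; [exact: measurable_cst|exact: measurable_funPT].
Qed.

Lemma sum_Lambda (f : 'rV[int]_d -> R) L :
  \sum_(n \in Lambda d L) f n = \sum_(i < Lambda_card d L) f (Lambda_site i).
Proof.
rewrite fsbig_finite//=; last exact: finite_Lambda.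
by rewrite (big_nth 0) big_mkord.
Qed.

Lemma beta_gt0 L : 0 < beta a delta L.
Proof.
rewrite /beta sum_Lambda.
have c0 : (0 < Lambda_card d L)%N.
  rewrite cardfs_gt0; apply/fset0Pn; exists 0.
  by rewrite in_fset_set ?inE//=; [move=> i; rewrite mxE normr0|exact: finite_Lambda].
rewrite (bigD1 (Ordinal c0))//= ltr_pwDl ?powR_gt0// sumr_ge0// => i _.
exact: powR_ge0.
Qed.

Lemma gammaL_measure L : exists m : {measure set R -> \bar R},
  forall B, m B = gammaL P a (fun n => q n) delta L B.
Proof.
have symH w : (H L w)^T = H L w by exact: hamiltonian_box_sym.
pose m i := projT1 (cid (mean_spectral_measure P symH
  (@measurable_hamiltonian_box L) i)).
have mE i B : m i B = ('E_P[fun w => spectral_measure (H L w) B i i])%E.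
  exact: (projT2 (cid (mean_spectral_measure P symH
    (@measurable_hamiltonian_box L) i))).
(* [msum] takes measures indexed by [nat], so the family is continued by zero past the last site. *)
pose m' k : {measure set R -> \bar R} :=
  if insub k is Some i then m i else mzero.
have b0 : 0 <= (beta a delta L)^-1 by rewrite invr_ge0 ltW// beta_gt0.
exists (mscale (NngNum b0) (msum m' (Lambda_card d L))) => B.
rewrite /mscale/= /msum /gammaL; congr (_ * _)%E.
by apply: eq_bigr => i _; rewrite /m' valK mE.
Qed.

Lemma adjacency_row_sum L (i : 'I_(Lambda_card d L)) :
  \sum_j `|(- @adjacency R d L) i j| <= 2 * d%:R.
Proof.
apply: le_trans (sum_adjacency i); apply: ler_sum => j _.
by rewrite mxE normrN mxE ger0_norm// ler0n.
Qed.

Lemma adjacency_col_sum L (j : 'I_(Lambda_card d L)) :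
  \sum_i `|(- @adjacency R d L) i j| <= 2 * d%:R.
Proof.
apply: le_trans (adjacency_row_sum j); apply: ler_sum => i _.
by rewrite [leRHS](_ : _ = `|(- adjacency L) i j|)// -{2}adjacency_sym !mxE.
Qed.

Hypotheses (hdelta : 1 < delta) (hq : forall n, has_density (q n) (rho delta)).

(** The expected number of sites with a_n |q_n| >= e is at most (e / 2)^(1 - delta) times [beta],
    which cancels the normalisation and makes the bound uniform in L. *)
Lemma gammaL_upper (e : R) : 0 < e -> exists C : R, forall L,
  (gammaL P a (fun n => q n) delta L
     [set r | (2 * d%:R + e + e <= `|r|)%R] <= C%:E)%E.
Proof.
move=> e0; set K : R := 2 * d%:R; set S := [set r | _].
have K0 : 0 <= K by rewrite mulr_ge0.
pose D := (K + e) ^+ 2 - K ^+ 2.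
have D0 : 0 < D by rewrite /D; nra.
exists ((K + e) ^+ 2 / D * (e / 2) `^ (1 - delta)) => L.
rewrite /gammaL; under eq_bigr do rewrite unlock.
set n := Lambda_card d L.
have symH w : (H L w)^T = H L w by exact: hamiltonian_box_sym.
have mf i : measurable_fun setT (fun w => (spectral_measure (H L w) S i i)%:E).
  apply/measurable_EFinP; apply: measurable_spectral_measure => //.
    exact: measurable_hamiltonian_box.
  exact: measurable_set_norm_ge.
rewrite -ge0_integral_sum//; last first.
  by move=> i w _; rewrite lee_fin (spectral_measure_ge0 (symH w)).
pose bad (i : 'I_n) :=
  [set w | e / a (Lambda_site i) <= `|q (Lambda_site i) w|].
have mbad i : measurable (bad i) by exact: measurable_norm_ge.
pose c := (K + e) ^+ 2 / D.
have c0 : 0 <= c by rewrite divr_ge0 ?sqr_ge0// ltW.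
have ptw w : (\sum_(i < n) (spectral_measure (H L w) S i i)%:E <=
    c%:E * \sum_(i < n) (\1_(bad i) w)%:E)%E.
  have [rs [urs sumP _ trP smE]] := spectral_resolution (symH w).
  have := @trace_far_spectral_measure _ _ _ (symH w) rs trP smE
    (- adjacency L) (V w) K (hamiltonian_boxE _ _ _) K0
    (@adjacency_col_sum L) (@adjacency_row_sum L) e e0.
  rewrite -/S -/D => h; rewrite !sumEFin -EFinM lee_fin.
  rewrite /c mulrAC ler_pdivlMr// mulrC (le_trans h)//.
  apply: ler_wpM2l; first exact: sqr_ge0.
  apply: ler_sum => i _; rewrite indicE /V normrM (gtr0_norm (ha _)).
  suff -> : (w \in bad i) =
    (e <= a (Lambda_site i) * `|q (Lambda_site i) w|)%R by [].
  rewrite [in RHS]mulrC -ler_pdivrMr//.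
  by apply/idP/idP => [/set_mem//|ew]; exact: mem_set.
apply: (@le_trans _ _ ((beta a delta L)^-1%:E * (c%:E *
    \sum_(i < n) ((e / a (Lambda_site i) / 2) `^ (1 - delta))%:E))%E).
  apply: lee_wpmul2l; first by rewrite lee_fin invr_ge0 ltW// beta_gt0.
  apply: (@le_trans _ _ (\int[P]_w (c%:E * \sum_(i < n) (\1_(bad i) w)%:E))%E).
    apply: ge0_le_integral => //.
    - move=> w _; apply: sume_ge0 => i _.
      by rewrite lee_fin (spectral_measure_ge0 (symH w)).
    - exact: emeasurable_sum.
    - apply: emeasurable_funM => //; apply: emeasurable_sum => i.
      exact/measurable_EFinP/measurable_indic.
    - by move=> w _; exact: ptw.
  have m1 i : measurable_fun setT (fun w => (\1_(bad i) w)%:E : \bar R).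
    exact/measurable_EFinP/measurable_indic.
  have -> : (\int[P]_w (c%:E * \sum_(i < n) (\1_(bad i) w)%:E) =
      c%:E * \int[P]_w (\sum_(i < n) (\1_(bad i) w)%:E))%E.
    apply: ge0_integralZl_EFin => //; last exact: emeasurable_sum.
    by move=> w _; apply: sume_ge0 => i _; rewrite lee_fin.
  apply: lee_wpmul2l; first by rewrite lee_fin.
  rewrite ge0_integral_sum//; apply: lee_sum => i _.
  rewrite integral_indic// setIT.
  by apply: power_law_tail => //; rewrite divr_gt0.
rewrite sumEFin -!EFinM lee_fin.
have -> : \sum_(i < n) (e / a (Lambda_site i) / 2) `^ (1 - delta) =
    (e / 2) `^ (1 - delta) * beta a delta L.
  rewrite /beta sum_Lambda mulr_sumr; apply: eq_bigr => i _.
  have a0 := ha (Lambda_site i).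
  have -> : e / a (Lambda_site i) / 2 = (e / 2) * a (Lambda_site i) `^ (-1).
    by rewrite powR_inv1 ?ltW// mulrAC.
  rewrite powRM ?powR_ge0 ?divr_ge0 ?(ltW e0)// -powRrM.
  by congr (_ * _ `^ _); ring.
have b0 := beta_gt0 L.
by rewrite mulrCA !mulrA mulrAC mulfVK ?gt_eqF.
Qed.

End density_of_states.

(** Nonzero lattice points have norm at least 1, so |n|^(-alpha) <= 1 there; the origin, left free
    by the comparison, contributes its own value. *)
Lemma comparable_to_power_bounded (R : realType) (d : nat)
    (a : 'rV[int]_d -> R) (alpha : R) : 0 <= alpha ->
  comparable_to_power a alpha -> exists2 A, 0 < A & forall n, a n <= A.
Proof.
move=> alpha0 [c1 [c2 [c10 c12 ac]]].
exists (Num.max c2 (a 0)) => [|n]; first by rewrite lt_max (lt_le_trans c10).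
have [->|n0] := eqVneq n 0; first by rewrite le_max lexx orbT.
have /andP[_ le_a] := ac n n0; rewrite le_max; apply/orP; left.
apply: (le_trans le_a); apply: ler_piMr; first exact: le_trans (ltW c10) c12.
have n1 : 1 <= enorm R n.
  rewrite /enorm -[leLHS]sqrtr1; apply: ler_wsqrtr.
  have [i ni] : exists i, n 0 i != 0.
    apply/existsP; apply: contraNT n0; rewrite negb_exists => /forallP h.
    by apply/eqP/rowP => i; have := h i; rewrite negbK mxE => /eqP.
  rewrite (bigD1 i)//= ler_wpDr//.
    by apply: sumr_ge0 => j _; exact: sqr_ge0.
  rewrite -(real_normK (num_real _)) exprn_ege1//.
  by rewrite -intr_norm ler1z -gtz0_ge1 normr_gt0.
rewrite powRN invf_le1 ?powR_gt0 ?(lt_le_trans ltr01)//.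
have <- : (1 : R) `^ alpha = 1 by rewrite powR1.
by apply: ge0_ler_powR; rewrite ?nnegrE// (le_trans ler01).
Qed.

Section density_of_states_lower.
Context {disp : measure_display} {Omega : measurableType disp} {R : realType}
  (P : probability Omega R) {d : nat}.
Variables (a : 'rV[int]_d -> R) (q : 'rV[int]_d -> {RV P >-> R}) (delta : R).
Hypotheses (ha : forall n, 0 < a n).
Hypotheses (hdelta : 1 < delta) (hq : forall n, has_density (q n) (rho delta)).

Let H L w := hamiltonian_box a (fun n => q n w) L.
Let V L w (i : 'I_(Lambda_card d L)) := a (Lambda_site i) * q (Lambda_site i) w.

(** As A / a_n >= 1, the interval lies where the density is a pure power, and scaling isolates the
    dependence on n in one factor. *)
Lemma site_probability (A : R) n : a n <= A ->
  P (q n @^-1` `[A / a n, (A + A) / a n]) =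
  (2^-1 * A `^ (1 - delta) * (1 - 2 `^ (1 - delta)) * a n `^ (delta - 1))%:E.
Proof.
move=> aA; have a0 := ha n; have A0 := lt_le_trans a0 aA.
rewrite (power_law_itv (hq n)); last 2 first.
- by rewrite ler_pdivlMr// mul1r.
- by rewrite ltr_pM2r ?invr_gt0//; lra.
congr EFin; have -> : A + A = 2 * A by ring.
have E : a n `^ (delta - 1) = (a n)^-1 `^ (1 - delta).
  by rewrite -powR_inv1 ?ltW// -powRrM; congr powR; ring.
have a'0 : 0 <= (a n)^-1 by rewrite invr_ge0 ltW.
have A2 : 0 <= 2 * A by rewrite mulr_ge0// ltW.
rewrite (powRM _ (ltW A0) a'0) (powRM _ A2 a'0) (powRM _ (ler0n _ 2) (ltW A0)) E.
ring.
Qed.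

Lemma gammaL_lower (M A : R) : (1 <= d)%N -> 0 < A -> (forall n, a n <= A) ->
  exists2 c : R, 0 < c & exists B, forall L,
  (c%:E <= gammaL P a (fun n => q n) delta L `[M, B])%E.
Proof.
move=> d1 A0 aA'; set K : R := 2 * d%:R.
have K2 : 2 <= K by rewrite /K ler_peMr// ler1n.
(* [A1] dominates every a_n, as [site_probability] needs, and A1 - K >= M, so a spectral window of
   radius K about a potential value in [A1, 2 A1] stays to the right of M. *)
pose A1 := A + `|M| + K.
have A1_gt0 : 0 < A1 by rewrite /A1; have := normr_ge0 M; lra.
have MA1 : M <= A1 - K by rewrite /A1; have := ler_norm M; lra.
have aA n : a n <= A1 by rewrite (le_trans (aA' n))// /A1; have := normr_ge0 M; lra.
pose p := 2^-1 * A1 `^ (1 - delta) * (1 - 2 `^ (1 - delta)).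
have p0 : 0 < p.
  rewrite /p !mulr_gt0 ?powR_gt0// subr_gt0 -(opprB delta) powRN invf_lt1 ?powR_gt0//.
  have one : (1 : R) `^ (delta - 1) = 1 by rewrite powR1.
  rewrite -[X in X < _]one.
  by apply: gt0_ltr_powR; rewrite ?nnegrE ?subr_gt0// ltr1n.
exists (p / 2); first by rewrite divr_gt0.
exists (A1 + A1 + K) => L.
rewrite /gammaL; under eq_bigr do rewrite unlock.
set n := Lambda_card d L.
have symH w : (H L w)^T = H L w by exact: hamiltonian_box_sym.
set S := `[M, _]%classic.
pose good (i : 'I_n) := q (Lambda_site i) @^-1`
  `[A1 / a (Lambda_site i), (A1 + A1) / a (Lambda_site i)].
have mgood i : measurable (good i).
  by rewrite -[X in measurable X]setTI; exact: measurable_funPT.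
have ptw w i : 2^-1 * \1_(good i) w <= spectral_measure (H L w) S i i.
  rewrite indicE; case: (boolP (w \in good i)) => [/set_mem gw|_]; last first.
    by rewrite mulr0 (spectral_measure_ge0 (symH w)).
  have [rs [urs sumP _ trP smE]] := spectral_resolution (symH w).
  have K0 : 0 <= K by rewrite (le_trans _ K2).
  have := @spectral_measure_near_potential _ _ _ (symH w) rs sumP trP smE
    (- adjacency L) (V w) K (hamiltonian_boxE _ _ _) K0 i.
  move=> /(_ (lt_le_trans (ltr0Sn R 1) K2)) near.
  rewrite mulr1; apply: (@le_trans _ _ (spectral_measure (H L w)
      [set r | `|r - V w i| <= K] i i)); last first.
    apply: (le_spectral_measure (symH w)) => r /= rV; rewrite /S/= in_itv/=.
    move: gw; rewrite /good/= !in_itv/= => /andP[].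
    rewrite ler_pdivrMr// ler_pdivlMr// mulrC -/(V w i) => V1 V2.
    move: rV; rewrite ler_norml => /andP[r1 r2]; apply/andP; split; lra.
  rewrite -[leLHS]mul1r; apply: near.
  (* The entries are 0 or -1, so their squares sum to at most K; then 2K <= K^2 because K = 2d >=
     2. *)
  have sq : \sum_j (- adjacency L) j i ^+ 2 <= K :> R.
    apply: le_trans (adjacency_col_sum i); apply: ler_sum => j _.
    rewrite !mxE normrN; case: (_ \in _); first by rewrite normr1 sqrrN expr1n.
    by rewrite normr0 oppr0 expr0n.
  apply: (@le_trans _ _ (2 * K)); first by rewrite ler_wpM2l.
  by rewrite expr2 ler_wpM2r.
have key i : ((p / 2 * a (Lambda_site i) `^ (delta - 1))%:E <=
    \int[P]_w (spectral_measure (H L w) S i i)%:E)%E.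
  apply: (@le_trans _ _ (\int[P]_w (2^-1%:E * (\1_(good i) w)%:E))%E).
    have -> : (\int[P]_w (2^-1%:E * (\1_(good i) w)%:E) =
        2^-1%:E * P (good i))%E.
      rewrite ge0_integralZl_EFin//; last exact/measurable_EFinP/measurable_indic.
      by rewrite integral_indic// setIT.
    rewrite site_probability// -EFinM lee_fin -/p.
    by rewrite mulrA (mulrC _ p).
  apply: ge0_le_integral => //.
  - by apply: emeasurable_funM => //; exact/measurable_EFinP/measurable_indic.
  - apply/measurable_EFinP; apply: measurable_spectral_measure => //.
      exact: measurable_hamiltonian_box.
    exact: measurable_itv.
  - by move=> w _; have := ptw w i; rewrite -lee_fin EFinM.
have b0 := beta_gt0 delta ha L.
apply: (@le_trans _ _ ((beta a delta L)^-1%:E * \sum_(i < n)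
    (p / 2 * a (Lambda_site i) `^ (delta - 1))%:E)%E); last first.
  apply: lee_wpmul2l; first by rewrite lee_fin invr_ge0 ltW.
  by apply: lee_sum => i _; exact: key.
have bE : beta a delta L = \sum_(i < n) a (Lambda_site i) `^ (delta - 1).
  exact: sum_Lambda.
rewrite sumEFin -EFinM lee_fin -mulr_sumr -bE.
by rewrite mulrCA mulVf ?gt_eqF// mulr1.
Qed.

End density_of_states_lower.

(** * Helly's selection theorem *)

Lemma diagonal_subsequence (R : realType) (u : nat -> nat -> R) (C : R) :
  (forall k j, `|u k j| <= C) ->
  exists2 phi : nat -> nat, increasing_seq phi &
    forall j, cvgn (fun k => u (phi k) j).
Proof.
move=> uC.
have bw (v : nat -> R) : (forall k, `|v k| <= C) ->
    {f : nat -> nat | increasing_seq f /\ cvgn (v \o f)}.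
  move=> vC; apply: cid.
  have [|f incf cf] := @bolzano_weierstrass R v.
    exists C; split; first exact: num_real.
    by move=> x Cx k _ /=; rewrite (le_trans (vC k))// ltW.
  by exists f.
pose next j (psi : nat -> nat) : nat -> nat :=
  projT1 (bw (fun k => u (psi k) j) (fun k => uC _ _)).
(* Along [psi j] all columns of index below j converge; the diagonal is eventually a subsequence of
   each [psi j]. *)
pose psi := fix psi j := if j is j'.+1 then psi j' \o next j' (psi j') else id.
have nextP j p : increasing_seq (next j p) /\ cvgn (fun k => u (p (next j p k)) j).
  exact: (projT2 (bw _ _)).
have incr_ge (f : nat -> nat) n : increasing_seq f -> (n <= f n)%N.
  move=> /increasing_seqP fi; elim: n => // n ih; exact: leq_ltn_trans ih (fi n).
have psi_incr j : increasing_seq (psi j).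
  elim: j => // j ih n m /=; rewrite ih; exact: (nextP j _).1.
have psi_tail m k n : exists2 n', (n <= n')%N & psi (m + k)%N n = psi m n'.
  elim: k n => [|k ih] n; first by rewrite addn0; exists n.
  rewrite addnS /=; have [n' nn' ->] := ih (next (m + k)%N (psi (m + k)%N) n).
  exists n' => //; apply: leq_trans nn'; apply: incr_ge; exact: (nextP _ _).1.
exists (fun k => psi k k).
  apply/increasing_seqP => k /=.
  have /increasing_seqP inc := psi_incr k.
  apply: (@lt_le_trans _ _ (psi k k.+1)); first exact: inc.
  rewrite (psi_incr k); apply: incr_ge; exact: (nextP _ _).1.
move=> j; have /cvg_ex[l /= ul] := (nextP j (psi j)).2.
apply/cvg_ex; exists l; apply/cvgrPdist_le => e e0.
move/cvgrPdist_le : ul => /(_ e e0)[N _ uN].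
near=> k.
have kj : (j.+1 <= k)%N by near: k; exists j.+1.
have kN : (N <= k)%N by near: k; exists N.
have [n' kn' E] := psi_tail j.+1 (k - j.+1)%N k.
rewrite subnKC// in E; rewrite E; apply: uN => /=; exact: leq_trans kn'.
Unshelve. all: by end_near. Qed.

(** * From limits at the rationals to a measure *)

Section rational_distribution_function.
Context {R : realType} (G : rat -> R) (C : R).
Hypotheses (ndG : {homo G : q r / q <= r}) (G0C : forall q, 0 <= G q <= C).

Let A (x : R) := [set G q | q in [set q | x < ratr q]].

(** Taking only rationals strictly beyond x makes the function right-continuous; the price is that
    its value at a rational may exceed that of [G]. *)
Definition right_limit (x : R) : R := inf (A x).

Local Notation F := right_limit.

Let A0 x : A x !=set0.
Proof.
have [q] := rat_in_itvoo (ltr_pwDr ltr01 (lexx x)).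
by rewrite in_itv/= => /andP[xq _]; exists (G q); exists q.
Qed.

Let lbA x y : (forall q, x < ratr q -> y <= G q) -> lbound (A x) y.
Proof. by move=> h _ [q /= xq <-]; exact: h. Qed.

Let has_lbA x : has_lbound (A x).
Proof. by exists 0; apply: lbA => q _; case/andP: (G0C q). Qed.

Lemma right_limit_le q x : x < ratr q -> F x <= G q.
Proof. by move=> xq; apply: inf_lbound => //; exists q. Qed.

Lemma right_limit_ge x y : (forall q, x < ratr q -> y <= G q) -> y <= F x.
Proof. by move=> h; apply: lb_le_inf => //; exact: lbA. Qed.

Lemma right_limit_rat q : G q <= F (ratr q).
Proof. by apply: right_limit_ge => r; rewrite ltr_rat => /ltW; exact: ndG. Qed.

Lemma right_limit_itv x : 0 <= F x <= C.
Proof.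
rewrite right_limit_ge/=; last by move=> q _; case/andP: (G0C q).
have [_ [q /= xq _]] := A0 x; rewrite (le_trans (right_limit_le xq))//.
by case/andP: (G0C q).
Qed.

Lemma right_limit_nondecreasing : nondecreasing F.
Proof.
move=> x y xy; apply: right_limit_ge => q yq; apply: right_limit_le.
exact: le_lt_trans yq.
Qed.

Lemma right_limit_right_continuous : right_continuous F.
Proof.
move=> x; apply/cvgrPdist_lt => e e0.
have [_ [q /= xq <-] Gq] := inf_adherent e0 (conj (A0 x) (has_lbA x)).
near=> y.
have yq : y < ratr q by near: y; exact: nbhs_right_lt.
have xy : x <= y by apply: ltW; near: y; exact: nbhs_right_gt.
have := right_limit_nondecreasing xy; have := right_limit_le yq.
move=> h1 h2; rewrite distrC ger0_norm ?subr_ge0// ltrBlDl.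
exact: le_lt_trans Gq.
Unshelve. all: by end_near. Qed.

Lemma right_limit_measure : exists2 gam : {measure set R -> \bar R},
  forall a b, a <= b -> gam `]a, b]%classic = (F b - F a)%:E &
  (gam setT <= C%:E)%E.
Proof.
pose Fc : cumulative R R := HB.pack F (@isCumulative.Build R _ R F
  right_limit_nondecreasing right_limit_right_continuous).
pose gam : {measure set (measurableTypeR R) -> \bar R} :=
  lebesgue_stieltjes_measure Fc.
have gamE a b : a <= b -> gam `]a, b]%classic = (F b - F a)%:E.
  move=> ab; rewrite /gam/= /lebesgue_stieltjes_measure /measure_extension.
  rewrite measurable_mu_extE/=; last exact: is_ocitv.
  by rewrite wlength_itv_bnd.
have gam0 : (gam : set R -> \bar R) set0 = 0%E by exact: measure0.
have gam_ge0 B : (0 <= (gam : set R -> \bar R) B)%E by exact: measure_ge0.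
have [|m mE] := measure_of_set_fun (T := R) gam0 gam_ge0.
  by move=> X mX tX mUX; exact: (@measure_semi_sigma_additive _ _ _ gam X mX tX mUX).
exists m; first by move=> a b ab; rewrite mE gamE.
rewrite mE.
have -> : [set: R] = \bigcup_n `](- n%:R), n%:R]%classic.
  exact/esym/bigcup_itvT.
have cvgI : (gam \o (fun n => `](- n%:R), n%:R]%classic)) n @[n --> \oo] -->
    gam (\bigcup_n `](- n%:R), n%:R]%classic).
  apply: nondecreasing_cvg_mu.
  - by move=> n; exact: measurable_itv.
  - by apply: bigcup_measurable => n _; exact: measurable_itv.
  - move=> k n kn; apply/subsetPset/subset_itv; rewrite bnd_simp ?lerN2 ler_nat//.
apply: (cvge_le _ cvgI); apply: nearW => n /=.
rewrite gamE ?ge0_cp// lee_fin.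
have := right_limit_itv n%:R; have := right_limit_itv (- n%:R); lra.
Qed.

End rational_distribution_function.

(** * Riemann sums with an error controlled by the total mass *)

Section riemann_sum.
Context {R : realType} (nu : {measure set R -> \bar R}) (C : R).
Hypothesis nuC : (nu setT <= C%:E)%E.

Let nu_fin B : measurable B -> (nu B < +oo)%E.
Proof.
move=> mB; apply: (@le_lt_trans _ _ (nu setT)).
  by apply: le_measure; rewrite ?inE.
exact: le_lt_trans nuC (ltry _).
Qed.

Lemma bounded_integrable (f : R -> R) (M : R) : measurable_fun setT f ->
  (forall y, `|f y| <= M) -> nu.-integrable setT (EFin \o f).
Proof.
move=> mf fM; apply: measurable_bounded_integrable => //; first exact: nu_fin.
exists M; split; first exact: num_real.
by move=> x Mx y _ /=; rewrite (le_trans (fM y))// ltW.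
Qed.

Lemma Rintegral_indic (B : set R) : measurable B ->
  \int[nu]_y (\1_B y) = fine (nu B).
Proof. by move=> mB; rewrite /Rintegral integral_indic// setIT. Qed.

(** The sum is the integral of the step function taking the left-end value on each half-open cell
    and 0 off the grid; it is within e of f everywhere. *)
Lemma riemann_sum_dist (f : R -> R) (x : nat -> R) (n : nat) (e : R) :
  measurable_fun setT f -> 0 <= e ->
  (forall i, x i <= x i.+1) ->
  (forall y, ~ `]x 0%N, x n]%classic y -> `|f y| <= e) ->
  (forall i y, (i < n)%N -> `]x i, x i.+1]%classic y -> `|f y - f (x i)| <= e) ->
  `|\int[nu]_y (f y) - \sum_(i < n) f (x i) * fine (nu `]x i, x i.+1]%classic)|
    <= e * C.
Proof.
move=> mf e0 ndx fout fin.
have xle i j : (i <= j)%N -> x i <= x j.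
  move=> ij; rewrite -(subnKC ij); elim: (j - i)%N => [|k ih].
    by rewrite addn0.
  by rewrite addnS (le_trans ih).
pose I i := `]x i, x i.+1]%classic.
have mI i : measurable (I i) by exact: measurable_itv.
pose s m y := \sum_(i < m) f (x i) * \1_(I i) y : R.
have ms m : measurable_fun setT (s m).
  apply: measurable_sum => i; apply: measurable_funM; first exact: measurable_cst.
  exact: measurable_indic.
have is_indic i : nu.-integrable setT (EFin \o (\1_(I i) : R -> R)).
  apply: (@bounded_integrable _ 1); first exact: measurable_indic.
  by move=> y; rewrite indicE; case: (_ \in _); rewrite ?normr1 ?normr0.
have is_s m : nu.-integrable setT (EFin \o s m).
  apply: (@bounded_integrable _ (\sum_(i < m) `|f (x i)|)) => // y.
  apply: (le_trans (ler_norm_sum _ _ _)); apply: ler_sum => i _.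
  rewrite normrM ler_piMr// indicE; case: (_ \in _); rewrite ?normr1 ?normr0//.
have sE m : \int[nu]_y (s m y) = \sum_(i < m) f (x i) * fine (nu (I i)).
  elim: m => [|m ih].
    rewrite big_ord0 /s; under eq_Rintegral do rewrite big_ord0.
    by rewrite Rintegral_cst// mul0r.
  rewrite big_ord_recr/= -ih -Rintegral_indic// -RintegralZl//.
  have iz : nu.-integrable setT (EFin \o (fun y => f (x m) * \1_(I m) y)).
    have -> : (EFin \o (fun y => f (x m) * \1_(I m) y)) =
      (fun y => ((f (x m))%:E * (EFin \o \1_(I m)) y)%E) by [].
    exact: integrableZl.
  rewrite -RintegralD//.
  by apply: eq_Rintegral => y _; rewrite /s big_ord_recr.
have fs y : `|f y - s n y| <= e.
  have [[i [iltn Iy]]|nI] := pselect (exists i, (i < n)%N /\ I i y).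
    suff -> : s n y = f (x i) by exact: fin.
    rewrite /s (bigD1 (Ordinal iltn))//= indicE mem_set// mulr1 big1 ?addr0//.
    move=> j ji; rewrite indicE memNset ?mulr0// /I/= in_itv/= => /andP[j1 j2].
    move: Iy; rewrite /I/= in_itv/= => /andP[i1 i2].
    have [ij|ij|ij] := ltngtP i j.
    - by have := lt_le_trans j1 (le_trans i2 (xle _ _ ij)); rewrite ltxx.
    - by have := lt_le_trans i1 (le_trans j2 (xle _ _ ij)); rewrite ltxx.
    - by move/eqP: ji; apply; apply/val_inj.
  have -> : s n y = 0.
    rewrite /s big1// => i _; rewrite indicE memNset ?mulr0// => Iy.
    by apply: nI; exists i.
  rewrite subr0; apply: fout => /= yin; apply: nI.
  elim: (n) yin => [|m ih].
    by rewrite in_itv/= => /andP[/lt_le_trans h /h]; rewrite ltxx.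
  rewrite in_itv/= => /andP[y0 ym]; have [yx|yx] := leP y (x m).
    have [|i [im Iy]] := ih; first by rewrite in_itv/= y0.
    by exists i; rewrite ltnS ltnW.
  by exists m; rewrite ltnS leqnn /I/= in_itv/= yx.
have is_fs : nu.-integrable setT (EFin \o (fun y => f y - s n y)).
  by apply: (@bounded_integrable _ e) => //; apply: measurable_funB.
have is_f : nu.-integrable setT (EFin \o f).
  apply: (@bounded_integrable _ (e + \sum_(i < n) `|f (x i)|)) => // y.
  rewrite -[f y](subrK (s n y)); apply: (le_trans (ler_normD _ _)).
  apply: lerD => //.
  apply: (le_trans (ler_norm_sum _ _ _)); apply: ler_sum => i _.
  rewrite normrM ler_piMr// indicE; case: (_ \in _); rewrite ?normr1 ?normr0//.
rewrite -sE -RintegralB//; apply: (le_trans (le_normr_Rintegral _ _)) => //.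
apply: (@le_trans _ _ (\int[nu]_(y in setT) e)).
  apply: le_Rintegral => //.
  - apply: (@bounded_integrable _ e); last by move=> y; rewrite normr_id.
    exact/measurableT_comp/measurable_funB.
  - by apply: (@bounded_integrable _ e) => // y; rewrite ger0_norm.
rewrite Rintegral_cst// ler_wpM2l// -lee_fin fineK//.
by rewrite ge0_fin_numE ?nu_fin.
Qed.

End riemann_sum.

(** Only x is confined to the segment. If no r works, Bolzano-Weierstrass gives pairs converging to
    a common limit whose images stay e apart. *)
Lemma uniform_continuity_segment (R : realType) (f : R -> R) (K e : R) :
  continuous f -> 0 < e ->
  exists2 r : R, 0 < r &
    forall x y, `|x| <= K -> `|y - x| < r -> `|f y - f x| <= e.
Proof.
move=> cf e0; apply: contrapT => nr.
have bad (n : nat) : {p : R * R | [/\ `|p.1| <= K, `|p.2 - p.1| < n.+1%:R^-1 &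
    e < `|f p.2 - f p.1|]}.
  apply: cid; apply: contrapT => np; apply: nr; exists n.+1%:R^-1.
    by rewrite invr_gt0.
  move=> x y xK xy; rewrite leNgt; apply/negP => exy.
  by apply: np; exists (x, y).
pose u n := (projT1 (bad n)).1; pose v n := (projT1 (bad n)).2.
have uK n : `|u n| <= K by have [] := projT2 (bad n).
have uv n : `|v n - u n| < n.+1%:R^-1 by have [] := projT2 (bad n).
have fuv n : e < `|f (v n) - f (u n)| by have [] := projT2 (bad n).
have [|phi incphi cu] := @bolzano_weierstrass R u.
  exists K; split; first exact: num_real.
  by move=> x Kx k _ /=; rewrite (le_trans (uK k))// ltW.
have /cvg_ex[l /= ul] := cu.
have phi_ge n : (n <= phi n)%N.
  move/increasing_seqP : incphi => fi.
  by elim: n => // n ih; exact: leq_ltn_trans ih (fi n).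
have vul : (v (phi n) - u (phi n)) @[n --> \oo] --> 0.
  apply: norm_cvg0; apply: (@squeeze_cvgr _ _ _ _ (fun=> 0) (fun n => n.+1%:R^-1)).
  - apply: nearW => n; rewrite normr_ge0/= ltW// (lt_le_trans (uv _))//.
    by rewrite lef_pV2 ?posrE// ler_nat ltnS.
  - exact: cvg_cst.
  - exact: cvg_harmonic.
have vl : v (phi n) @[n --> \oo] --> l.
  have -> : (fun n => v (phi n)) = (fun n => (v (phi n) - u (phi n)) + u (phi n)).
    by apply/funext => n; rewrite subrK.
  by rewrite -[l]add0r; exact: cvgD.
have fl : (f (v (phi n)) - f (u (phi n))) @[n --> \oo] --> 0.
  rewrite -(subrr (f l)); apply: cvgB.
    exact: (cvg_comp _ _ vl (cf l)).
  exact: (cvg_comp _ _ ul (cf l)).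
move/cvgrPdist_lt : fl => /(_ _ e0)[N _ /(_ N (leqnn N))].
by rewrite sub0r normrN ltNge ltW.
Qed.

(* Summation by parts: the increments of [f] are small and the [D i] are
   dominated by the increments of a bounded nondecreasing sequence. *)
Lemma summation_by_parts_le (R : realDomainType) (f D G : nat -> R) (e C : R)
    (n : nat) : 0 <= e -> f 0%N = 0 -> f n = 0 ->
  (forall i, (i < n)%N -> `|f i.+1 - f i| <= e) ->
  (forall i, (i < n)%N -> 0 <= D i <= G i.+1 - G i) -> 0 <= D n <= C ->
  `|\sum_(i < n) f i * (D i.+1 - D i)| <= e * (G n - G 0%N + C).
Proof.
move=> e0 f0 fn fe DG DnC.
have parts m : \sum_(i < m) f i * (D i.+1 - D i) =
    f m * D m - f 0%N * D 0%N - \sum_(i < m) (f i.+1 - f i) * D i.+1.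
  elim: m => [|m ih]; first by rewrite !big_ord0 subrr subr0.
  by rewrite !big_ord_recr/= ih; ring.
have DnG m : (m <= n)%N -> \sum_(i < m) D i <= G m - G 0%N.
  elim: m => [|m ih] mn; first by rewrite big_ord0 subrr.
  rewrite big_ord_recr/= (le_trans (lerD (ih (ltnW mn)) (andP (DG _ mn)).2))//.
  by rewrite addrC subrKA.
rewrite parts f0 fn !mul0r subr0 sub0r normrN.
apply: (le_trans (ler_norm_sum _ _ _)).
have D0 i : (i <= n)%N -> 0 <= D i.
  rewrite leq_eqVlt => /orP[/eqP->|/DG/andP[]//]; by case/andP: DnC.
apply: (@le_trans _ _ (\sum_(i < n) e * D i.+1)).
  apply: ler_sum => i _; rewrite normrM (ger0_norm (D0 _ _))//.
  by apply: ler_wpM2r; [exact: D0|exact: fe].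
rewrite -mulr_sumr; apply: ler_wpM2l => //.
apply: (@le_trans _ _ (\sum_(i < n.+1) D i)).
  by rewrite big_ord_recl/= lerDr D0.
by rewrite big_ord_recr/= lerD ?DnG//; case/andP: DnC.
Qed.

(* The limit distribution function is only known to be the limit at rational
   points up to its jumps, which summation by parts makes harmless. *)
Theorem helly_selection (R : realType) (mu : nat -> {measure set R -> \bar R})
    (C : R) : (forall k, (mu k setT <= C%:E)%E) ->
  exists2 phi : nat -> nat, increasing_seq phi &
  exists2 gam : {measure set R -> \bar R}, (gam setT <= C%:E)%E &
  forall (f : R -> R) (K : R), continuous f -> (forall x, K <= `|x| -> f x = 0) ->
    \int[mu (phi k)]_x f x @[k --> \oo] --> \int[gam]_x f x.
Proof.
move=> muC.
have C0 : 0 <= C by rewrite -lee_fin (le_trans _ (muC 0%N)).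
have mu_le k B : measurable B -> (mu k B <= C%:E)%E.
  by move=> mB; rewrite (le_trans _ (muC k))//; apply: le_measure; rewrite ?inE.
have mu_fin k B : measurable B -> mu k B \is a fin_num.
  by move=> mB; rewrite ge0_fin_numE// (le_lt_trans (mu_le _ _ mB))// ltry.
have mray (x : R) : measurable `]-oo, x]%classic by exact: measurable_itv.
pose g k x := fine (mu k `]-oo, x]%classic).
have g0C k x : 0 <= g k x <= C.
  rewrite fine_ge0//= -lee_fin fineK; [exact: mu_le|exact: mu_fin].
have gB k a b : a <= b -> fine (mu k `]a, b]%classic) = g k b - g k a.
  move=> ab; apply/eqP; rewrite eq_sym subr_eq addrC; apply/eqP.
  rewrite /g -fineD ?mu_fin//; congr fine; rewrite -measureU//.
    by rewrite -itv_bndbnd_setU// bnd_simp.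
  rewrite -subset0 => y []; rewrite /= !in_itv/= => ya /andP[].
  by rewrite ltNge ya.
have ndg k : nondecreasing (g k).
  by move=> a b ab; rewrite -subr_ge0 -gB// fine_ge0.
pose q_ (j : nat) : rat := odflt 0 (choice.unpickle j).
have [|phi incphi cphi] := @diagonal_subsequence R (fun k j => g k (ratr (q_ j))) C.
  by move=> k j; have /andP[g0 gC] := g0C k (ratr (q_ j)); rewrite ger0_norm.
exists phi => //.
pose G (q : rat) : R := limn (fun k => g (phi k) (ratr q)).
have cG q : g (phi k) (ratr q) @[k --> \oo] --> G q.
  by have := cphi (choice.pickle q); rewrite /q_ choice.pickleK.
have G0C q : 0 <= G q <= C.
  apply/andP; split.
    by apply: limr_ge; [exact: cG|apply: nearW => k; case/andP: (g0C (phi k) (ratr q))].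
  by apply: limr_le; [exact: cG|apply: nearW => k; case/andP: (g0C (phi k) (ratr q))].
have ndG : {homo G : q r / q <= r}.
  move=> q r qr; apply: (ler_lim (cG q) (cG r)).
  by apply: nearW => k; apply: ndg; rewrite ler_rat.
have [gam gamE gamC] := right_limit_measure G0C.
exists gam => // f K cf fK.
have mf : measurable_fun setT f by exact: continuous_measurable_fun.
apply/cvgrPdist_le => eps eps0.
(* The errors are e C for each of the two Riemann sums, 2 e C for the jumps and e for the
   convergence on the grid. *)
pose e := eps / (4 * C + 1).
have e0 : 0 < e by rewrite divr_gt0//; lra.
pose N := Num.bound K.
have KN : K <= N%:R.
  exact/ltW/unstable.ltr_bound.
have fN x : N%:R <= `|x| -> f x = 0.
  by move=> Nx; apply: fK; exact: le_trans KN Nx.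
have [r r0 fr] := uniform_continuity_segment N%:R cf e0.
pose M := (Num.bound r^-1).+1.
have Mr : M%:R^-1 < r.
  rewrite invf_plt ?posrE// (@lt_trans _ _ (Num.bound r^-1)%:R)//.
    exact: unstable.ltr_bound.
  by rewrite ltr_nat.
pose n := (N.*2 * M)%N.
(* The grid consists of rationals, where the distribution functions converge along [phi]. *)
pose p (i : nat) : rat := - N%:R + i%:R / M%:R.
pose x (i : nat) : R := ratr (p i).
have xE i : x i = - N%:R + i%:R / M%:R.
  by rewrite /x /p rmorphD rmorphN/= fmorph_div/= !rmorph_nat.
have x0 : x 0%N = - N%:R by rewrite xE mul0r addr0.
have xn : x n = N%:R.
  rewrite xE /n natrM mulfK ?pnatr_eq0// -muln2 natrM; ring.
have xS i : x i.+1 - x i = M%:R^-1.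
  by rewrite !xE -natr1 mulrDl mul1r; ring.
have ndx i : x i <= x i.+1 by rewrite -subr_ge0 xS invr_ge0.
have xN i : (i <= n)%N -> `|x i| <= N%:R.
  move=> iltn; rewrite ler_norml xE lerDl mulr_ge0 ?invr_ge0//=.
  by rewrite -[leRHS]xn xE lerD2l ler_wpM2r ?invr_ge0// ler_nat.
have fdist i y : (i < n)%N -> `]x i, x i.+1]%classic y -> `|f y - f (x i)| <= e.
  move=> iltn; rewrite /= in_itv/= => /andP[y1 y2]; apply: fr.
    by apply: xN; exact: ltnW.
  rewrite gtr0_norm ?subr_gt0//; have := xS i; lra.
have fout y : ~ `]x 0%N, x n]%classic y -> `|f y| <= e.
  rewrite x0 xn /= in_itv/= => /negP; rewrite negb_and => yout.
  suff yN : N%:R <= `|y| by rewrite fN// normr0 ltW.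
  case/orP: yout; rewrite -?leNgt -?ltNge => h.
    by rewrite ler_normr orbC lerNr h.
  by rewrite ler_normr (ltW h).
pose S (nu : {measure set R -> \bar R}) :=
  \sum_(i < n) f (x i) * fine (nu `]x i, x i.+1]%classic).
have muS k : `|\int[mu k]_y f y - S (mu k)| <= e * C.
  exact: (riemann_sum_dist (muC k) mf (ltW e0) ndx fout fdist).
have gamS : `|\int[gam]_y f y - S gam| <= e * C.
  exact: (riemann_sum_dist gamC mf (ltW e0) ndx fout fdist).
pose SG := \sum_(i < n) f (x i) * (G (p i.+1) - G (p i)).
have muG : S (mu (phi k)) @[k --> \oo] --> SG.
  apply: (@cvg_big _ _ +%R) => [|i _]; first by apply: add_continuous.
  apply: cvgM; first exact: cvg_cst.
  by under eq_fun do rewrite gB//; apply: cvgB; exact: cG.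
pose F := right_limit G.
have gamG : `|S gam - SG| <= e * (2 * C).
  have -> : S gam - SG = \sum_(i < n) f (x i) *
      ((F (x i.+1) - G (p i.+1)) - (F (x i) - G (p i))).
    rewrite -sumrB; apply: eq_bigr => i _; rewrite gamE//=; ring.
  apply: (le_trans (@summation_by_parts_le _ (f \o x)
    (fun i => F (x i) - G (p i)) (G \o p) e C n (ltW e0) _ _ _ _ _)) => /=.
  - by rewrite fN// x0 normrN normr_nat.
  - by rewrite fN// xn normr_nat.
  - move=> i iltn; apply: fdist => //=; rewrite in_itv/= lexx andbT.
    by rewrite -subr_gt0 xS invr_gt0.
  (* The defect F - G at a grid point lies between 0 and the next increment of G, since F is at most
     G at any later rational. *)
  - move=> i iltn; rewrite subr_ge0 (right_limit_rat ndG)/=  lerD2r.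
    apply: (right_limit_le G0C).
    by rewrite -/(x i) -/(x i.+1) -subr_gt0 xS invr_gt0.
  - have := right_limit_itv G0C (x n); have := G0C (p n).
    have := right_limit_rat ndG (p n); rewrite -/F -/(x n); lra.
  apply: ler_wpM2l; first exact: ltW.
  have := G0C (p n); have := G0C (p 0%N); lra.
near=> k.
have muGk : `|SG - S (mu (phi k))| <= e.
  by near: k; move/cvgrPdist_le : muG; exact.
have eE : eps = e * C + e * (2 * C) + e + e * C.
  rewrite /e; field; lra.
have -> : \int[gam]_y f y - \int[mu (phi k)]_y f y =
  (\int[gam]_y f y - S gam) + (S gam - SG) + (SG - S (mu (phi k))) -
  (\int[mu (phi k)]_y f y - S (mu (phi k))) by ring.
rewrite eE; apply: (le_trans (ler_normB _ _)); apply: lerD => //.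
apply: (le_trans (ler_normD _ _)); apply: lerD => //.
by apply: (le_trans (ler_normD _ _)); apply: lerD.
Unshelve. all: by end_near. Qed.

(** * Restriction to the complement of an interval *)

Lemma outsideP (R : realType) (M1 M2 x : R) :
  outside M1 M2 x <-> x <= M1 \/ M2 <= x.
Proof.
rewrite /outside /= in_itv/=; split.
  move/negP; rewrite negb_and -!leNgt => /orP[]; [by left|by right].
by move=> xM; apply/negP; rewrite negb_and -!leNgt; apply/orP.
Qed.

Lemma continuous_comp_within (R : realType) (S : set R) (f h : R -> R) :
  {within S, continuous f} -> continuous h -> (forall x, S (h x)) ->
  continuous (f \o h).
Proof.
move=> /subspace_continuousP cf ch hS x.
apply: (cvg_comp _ _ _ (cf (h x) (hS x))) => A.
move=> hA; have : nbhs x (h @^-1` [set z | S z -> A z]) := ch x _ hA.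
by apply: filterS => y; apply.
Qed.

(** Clamping to each half-line gives two continuous functions; the subtracted affine ramp removes
    the constant one of them contributes on either side, and interpolates linearly in the gap. *)
Lemma continuous_extension_outside (R : realType) (M1 M2 : R) (f : R -> R) :
  M1 < M2 -> {within outside M1 M2, continuous f} ->
  exists2 F : R -> R, continuous F & forall x, outside M1 M2 x -> F x = f x.
Proof.
move=> M12 cf.
pose lo x := Num.min x M1; pose hi x := Num.max x M2.
pose ramp x := (Num.min (Num.max x M1) M2 - M1) / (M2 - M1).
have cid : continuous (fun x : R => x) by move=> x A; exact.
have ccst (c : R) : continuous (fun _ : R => c) by move=> x; exact: cvg_cst.
have clo : continuous lo by move=> x; exact: continuous_min (cid x) (ccst _ x).
have chi : continuous hi by move=> x; exact: continuous_max (cid x) (ccst _ x).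
have cramp : continuous ramp.
  move=> x; apply: cvgM; last exact: cvg_cst.
  apply: cvgB; last exact: cvg_cst.
  exact: (@continuous_min R R (fun y => Num.max y M1) (fun=> M2) x
    (continuous_max (cid x) (ccst _ x)) (ccst _ x)).
have cflo : continuous (f \o lo).
  apply: (continuous_comp_within cf clo) => x; apply/outsideP; left.
  by rewrite /lo ge_min lexx orbT.
have cfhi : continuous (f \o hi).
  apply: (continuous_comp_within cf chi) => x; apply/outsideP; right.
  by rewrite /hi le_max lexx orbT.
exists (fun x => f (lo x) + f (hi x) - (f M2 + (f M1 - f M2) * ramp x)).
  move=> x; apply: cvgB; first exact: cvgD (cflo x) (cfhi x).
  by apply: cvgD; [exact: cvg_cst|apply: cvgM; [exact: cvg_cst|exact: cramp]].
move=> x /outsideP[xM|xM]; rewrite /ramp /lo /hi.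
  rewrite (min_l xM) (max_r (le_trans xM (ltW M12))) (max_r xM) (min_l (ltW M12)).
  by rewrite subrr mul0r mulr0 addr0 addrK.
rewrite (min_r (le_trans (ltW M12) xM)) (max_l xM).
rewrite (max_l (le_trans (ltW M12) xM)) (min_r xM) divff ?subr_eq0 ?gt_eqF//.
ring.
Qed.

Section finite_measure_integrals.
Context {R : realType} (nu : {measure set R -> \bar R}) (C : R).
Hypothesis nuC : (nu setT <= C%:E)%E.

Lemma continuous_support_integrable (f : R -> R) (K : R) : continuous f ->
  (forall x, K <= `|x| -> f x = 0) -> nu.-integrable setT (EFin \o f).
Proof.
move=> cf fK; have mf : measurable_fun setT f by exact: continuous_measurable_fun.
have [M MP] : exists M, forall x, `|x| <= `|K| -> `|f x| <= M.
  have Kle : - `|K| <= `|K| by have := normr_ge0 K; lra.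
  have cnf : {within `[- `|K|, `|K|], continuous (fun x => `|f x|)}.
    apply: continuous_subspaceT => x; apply: continuous_comp; first exact: cf.
    exact: norm_continuous.
  have [c _ cP] := EVT_max Kle cnf.
  by exists `|f c| => x; rewrite ler_norml => xK; apply: cP; rewrite in_itv.
apply: (@bounded_integrable _ _ _ nuC _ (Num.max M 0)) => // x.
have [xK|Kx] := leP `|x| `|K|; first by rewrite le_max MP.
by rewrite fK ?normr0 ?le_max ?lexx ?orbT// (le_trans (ler_norm K))// ltW.
Qed.

Lemma Rintegral_EFin (f : R -> R) : nu.-integrable setT (EFin \o f) ->
  (\int[nu]_x (f x)%:E = (\int[nu]_x f x)%:E)%E.
Proof. by move=> intf; rewrite /Rintegral fineK//; exact: integrable_fin_num. Qed.

Lemma integral_null_complement (S : set R) (f F : R -> R) : measurable S ->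
  nu (~` S) = 0%E -> nu.-integrable setT (EFin \o F) ->
  (forall x, S x -> F x = f x) ->
  (\int[nu]_(x in S) (f x)%:E = (\int[nu]_x F x)%:E)%E.
Proof.
move=> mS nuS intF Ff; rewrite -Rintegral_EFin//.
rewrite (negligible_integral (measurableC mS) measurableT intF nuS) setTD setCK.
by apply: eq_integral => x /set_mem Sx; rewrite /= Ff.
Qed.

Lemma restr_complement (S : set R) (mS : measurable S) : mrestr nu mS (~` S) = 0%E.
Proof. by rewrite /mrestr setICl measure0. Qed.

(** Continuous, and positive exactly on ]a, b[: its integral detects whether a measure charges that
    open interval. *)
Definition tent (a b x : R) := Num.max 0 (Num.min (x - a) (b - x)).

Lemma continuous_tent a b : continuous (tent a b).
Proof.
move=> x; apply: (@continuous_max R R (fun=> 0) (fun y => Num.min (y - a) (b - y))).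
  exact: cvg_cst.
apply: (@continuous_min R R (fun y => y - a) (fun y => b - y)).
  by apply: cvgB; [move=> A; exact|exact: cvg_cst].
by apply: cvgB; [exact: cvg_cst|move=> A; exact].
Qed.

Lemma tent_support a b x : `|a| + `|b| <= `|x| -> tent a b x = 0.
Proof.
move=> abx; apply: max_l; rewrite ge_min.
have hb := ler_norm b; have ha : - a <= `|a| by rewrite -normrN ler_norm.
have a0 := normr_ge0 a; have b0 := normr_ge0 b.
move: abx; have [x0|x0] := leP 0 x; rewrite ?(ger0_norm x0) ?(ltr0_norm x0) => abx.
  by apply/orP; right; lra.
by apply/orP; left; lra.
Qed.

Lemma tent_eq0 (a b : R) : \int[nu]_x tent a b x = 0 -> nu `]a, b[%classic = 0%E.
Proof.
move=> I0; have intf := continuous_support_integrable (@continuous_tent a b)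
  (@tent_support a b).
have t0 x : 0 <= tent a b x by rewrite /tent le_max lexx.
have ae0 : ae_eq nu setT (EFin \o tent a b) (cst 0%E).
  apply/ae_eq_integral_abs => //; first exact: (measurable_int nu).
  under eq_integral do rewrite /= ger0_norm//.
  by rewrite Rintegral_EFin// I0.
apply: measure_negligible; first exact: measurable_itv.
apply: negligibleS ae0 => x /=; rewrite in_itv/= => /andP[ax xb] /(_ I) /eqP.
by rewrite eqe gt_eqF// /tent lt_max lt_min !subr_gt0 ax xb orbT.
Qed.

(** A compactly supported continuous majorant of the indicator of [-K, K], used to carry a lower
    mass bound to the limit. *)
Definition trapezoid (K x : R) := Num.max 0 (Num.min 1 (K + 1 - `|x|)).

Lemma continuous_trapezoid K : continuous (trapezoid K).
Proof.
move=> x; apply: (@continuous_max R R (fun=> 0) (fun y => Num.min 1 (K + 1 - `|y|))).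
  exact: cvg_cst.
apply: (@continuous_min R R (fun=> 1) (fun y => K + 1 - `|y|)).
  exact: cvg_cst.
by apply: cvgB; [exact: cvg_cst|exact: norm_continuous].
Qed.

Lemma trapezoid_support K x : K + 1 <= `|x| -> trapezoid K x = 0.
Proof. by move=> Kx; apply: max_l; rewrite ge_min subr_le0 Kx orbT. Qed.

Lemma le_Rintegral_trapezoid (a b : R) :
  (nu `[a, b]%classic <= (\int[nu]_x trapezoid (`|a| + `|b|) x)%:E)%E.
Proof.
set K := `|a| + `|b|.
have intf := continuous_support_integrable (@continuous_trapezoid K)
  (@trapezoid_support K).
have mab : measurable `[a, b]%classic by exact: measurable_itv.
rewrite -Rintegral_EFin//.
have -> : (nu `[a, b]%classic = \int[nu]_x (\1_(`[a, b]%classic) x)%:E)%E.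
  by rewrite integral_indic// setIT.
apply: ge0_le_integral => //.
- exact/measurable_EFinP/measurable_indic.
- exact: (measurable_int nu).
- move=> x _; rewrite lee_fin indicE; case: (boolP (x \in _)) => [/set_mem|_].
    rewrite /= in_itv/= => /andP[ax xb]; rewrite /trapezoid le_max le_min lexx/=.
    apply/orP; right; suff : `|x| <= K by lra.
    have hb := ler_norm b; have ha : - a <= `|a| by rewrite -normrN ler_norm.
    have a0 := normr_ge0 a; have b0 := normr_ge0 b; rewrite /K ler_norml.
    by apply/andP; split; lra.
  by rewrite /trapezoid le_max lexx.
Qed.

End finite_measure_integrals.

Theorem corollary1p7 (R : realType) (disp : measure_display)
    (Omega : measurableType disp) (P : probability Omega R)
    (d : nat) (hd : (1 <= d)%N)
    (alpha delta : R) (halpha : 0 < alpha) (hdelta : 1 < delta)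
    (hdim : 0 < d%:R - alpha * (delta - 1))
    (a : 'rV[int]_d -> R) (ha : forall n, 0 < a n)
    (hapow : comparable_to_power a alpha)
    (q : 'rV[int]_d -> {RV P >-> R})
    (hindep : mutually_independent q)
    (hdens : forall n, has_density (q n) (rho delta))
    (M1 M2 : R) (hM1 : M1 < - (2 * d%:R)) (hM2 : 2 * d%:R < M2) :
  exists2 gamma_ : nat -> {measure set R -> \bar R},
    (forall L (B : set R), measurable B ->
       gamma_ L B = gammaL P a (fun n => q n) delta L B) &
    exists (phi : nat -> nat) (gamma : {measure set R -> \bar R}),
      [/\ increasing_seq phi,
          locally_finite_on (outside M1 M2) gamma,
          vague_cvg_on (outside M1 M2)
            (fun k => mrestr (gamma_ (phi k)) (measurable_outside M1 M2)) gamma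
        & gamma (outside M1 M2) != 0%E].
Proof.
have [A A0 aA] := comparable_to_power_bounded (ltW halpha) hapow.
set S := outside M1 M2.
have mS : measurable S := measurable_outside M1 M2.
pose gamma_ L : {measure set R -> \bar R} :=
  projT1 (cid (gammaL_measure q delta ha L)).
have gammaE L B : gamma_ L B = gammaL P a (fun n => q n) delta L B.
  exact: (projT2 (cid (gammaL_measure q delta ha L))).
exists gamma_ => [L B _|]; first exact: gammaE.
(* Half the smaller distance from the band [-2d, 2d] to M1 and M2, so that |r| >= 2d + 2e throughout
   [S]. *)
pose e := Num.min (M2 - 2 * d%:R) (- M1 - 2 * d%:R) / 2.
have e0 : 0 < e by rewrite divr_gt0// lt_min; apply/andP; split; lra.
have [C upC] := gammaL_upper ha hdelta hdens e0.
pose nu L : {measure set R -> \bar R} := mrestr (gamma_ L) mS.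
have nuE L B : nu L B = gamma_ L (B `&` S) by [].
have nuC L : (nu L setT <= C%:E)%E.
  rewrite nuE setTI (le_trans _ (upC L))// -gammaE; apply: le_measure.
  - by rewrite inE.
  - by rewrite inE; exact: measurable_set_norm_ge.
  - move=> x /outsideP xM /=.
    have e1 : e + e <= M2 - 2 * d%:R.
      by rewrite /e -splitr ge_min lexx.
    have e2 : e + e <= - M1 - 2 * d%:R.
      by rewrite /e -splitr ge_min lexx orbT.
    rewrite -addrA ler_normr; apply/orP; case: xM => xM; [right|left]; lra.
have [phi incphi [gam gamC gamW]] := helly_selection nuC.
have gam0 : gam (~` S) = 0%E.
  rewrite /S setCK; apply: (tent_eq0 gamC).
  have := gamW _ _ (@continuous_tent R M1 M2) (@tent_support R M1 M2).
  (* The tent over ]M1, M2[ vanishes on [S], which carries each restricted measure; the zero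
     integrals pass to the limit. *)
  have zero k : \int[nu (phi k)]_x tent M1 M2 x = 0.
    apply: EFin_inj.
    rewrite -(@integral_null_complement R (nu (phi k)) S (fun=> 0) _ mS).
    - by rewrite integral0.
    - exact: restr_complement.
    - exact: (continuous_support_integrable (nuC _) (@continuous_tent R M1 M2)
        (@tent_support R M1 M2)).
    - move=> x /outsideP xM; apply: max_l; rewrite ge_min !subr_le0.
      by apply/orP; case: xM; [left|right].
  under eq_fun do rewrite zero.
  by move/cvg_lim => <-//; rewrite lim_cst.
have [c c0 [B cB]] := gammaL_lower ha hdelta hdens M2 hd A0 aA.
have cphi k : c <= \int[nu (phi k)]_x trapezoid (`|M2| + `|B|) x.
  rewrite -lee_fin; apply: (le_trans _ (le_Rintegral_trapezoid (nuC _) M2 B)).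
  (* The interval [M2, B] lies inside [S], so restriction loses none of its mass. *)
  rewrite nuE setIidl ?gammaE// => x; rewrite /= in_itv/= => /andP[Mx _].
  by apply/outsideP; right.
have cgam : c <= \int[gam]_x trapezoid (`|M2| + `|B|) x.
  have := gamW _ _ (@continuous_trapezoid R (`|M2| + `|B|))
    (@trapezoid_support R (`|M2| + `|B|)).
  move=> cv; rewrite -(cvg_lim _ cv)//; apply: limr_ge; last exact: nearW.
  exact: cvgP cv.
exists phi, gam; split => //.
- split=> // K cK KS; apply: (@le_lt_trans _ _ (gam setT)).
    apply: le_measure; rewrite ?inE//.
    by apply: closed_measurable; exact: (compact_closed (@Rhausdorff R)).
  exact: le_lt_trans gamC (ltry _).
- move=> f cf [K [cK KS fK]].
  have M12 : M1 < M2 by have := ler0n R d; lra.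
  have [F cF Ff] := continuous_extension_outside M12 cf.
  have [b [_ bK]] := compact_bounded cK.
  (* Beyond [T] a point is outside the gap, where F = f, and off the support K: boundedness gives
     |x| <= b + 1 on K, and b + 2 makes the exclusion strict. *)
  pose T := Num.max (b + 2) (Num.max (`|M1| + 1) (`|M2| + 1)).
  have FT x : T <= `|x| -> F x = 0.
    rewrite /T !ge_max => /and3P[xb x1 x2].
    have Sx : S x.
      apply/outsideP; have h1 := ler_norm M1; have h2 := ler_norm M2.
      have h3 : - M1 <= `|M1| by rewrite -normrN ler_norm.
      have h4 : - M2 <= `|M2| by rewrite -normrN ler_norm.
      have [x0|x0] := leP 0 x; [right|left].
        by move: x2; rewrite (ger0_norm x0); lra.
      by move: x1; rewrite (ltr0_norm x0); lra.
    rewrite Ff// fK// => Kx.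
    have bb : b < b + 1 by rewrite ltrDl.
    have xb' : `|x| <= b + 1 := bK _ bb x Kx.
    lra.
  have toR (m : {measure set R -> \bar R}) : (m setT <= C%:E)%E ->
      m (~` S) = 0%E ->
      (\int[m]_(x in S) (f x)%:E = (\int[m]_x F x)%:E)%E.
    move=> mC mS0; apply: (integral_null_complement mS mS0) => //.
    exact: (continuous_support_integrable mC cF FT).
  rewrite (toR gam gamC gam0).
  have -> : (fun k => \int[nu (phi k)]_(x in S) (f x)%:E)%E =
      (fun k => (\int[nu (phi k)]_x F x)%:E).
    by apply/funext => k; apply: toR => //; exact: restr_complement.
  by apply: cvg_EFin; [exact: nearW|exact: gamW cF FT].
- apply/eqP => gamS; have gamT : gam setT = 0%E.
    have -> : (gam setT = gam S + gam (~` S))%E.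
      by rewrite -(setUv S); apply: measureU; rewrite ?setICr//; exact: measurableC.
    by rewrite gamS gam0 adde0.
  move: cgam; rewrite leNgt => /negP; apply.
  rewrite /Rintegral (negligible_integral measurableT measurableT _ gamT)//.
    by rewrite setDv integral_set0.
  exact: (continuous_support_integrable gamC (@continuous_trapezoid R _)
    (@trapezoid_support R _)).
Qed.
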